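(* Let $f:\mathbb{C}^n \to\mathbb{C}^n$ be a proper polynomial mapping with $\mu(f)=2$. If the Linearization Conjecture is true (in dimension $n$), then $f$ is weakly equivalent to the mapping $$g:\mathbb{C}^n \ni (x_1, x_2, \ldots, x_n)\mapsto (x_1^2, x_2,\ldots, x_n)\in\mathbb{C}^n.$$
   Context: The Linearization Conjecture (in dimension $n$) is the assertion: for every polynomial automorphism $\Phi : \mathbb{C}^n\to \mathbb{C}^n$ of order two there exists a polynomial automorphism $\Psi:\mathbb{C}^n\to \mathbb{C}^n$ such that $\Psi^{-1}\circ\Phi\circ \Psi \in GL(n)$, i.e. is a linear automorphism of $\mathbb{C}^n$. A proper polynomial mapping $f:\mathbb{C}^n\to\mathbb{C}^n$ has finite fibers; its topological degree $\mu(f)$ is the number of points of the fiber over any point that is not a critical value of $f$. Two proper polynomial mappings $f,g:\mathbb{C}^n\to\mathbb{C}^n$ are weakly equivalent if there exist polynomial automorphisms $\Phi,\Psi$ of $\mathbb{C}^n$ such that $g=\Psi\circ f\circ\Phi$. *)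

(* Defs.v *)
From mathcomp Require Import all_boot all_order all_algebra.
From mathcomp Require Import complex.
(* The notations of mpoly clash with those of mathcomp-analysis. *)
From mathcomp Require Import -(notations) mpoly.
From mathcomp Require Import boolp classical_sets functions cardinality.
From mathcomp Require Import reals topology normedtype.

Set Implicit Arguments.
Unset Strict Implicit.
Unset Printing Implicit Defensive.

Import Order.TTheory GRing.Theory Num.Theory.
Import numFieldNormedType.Exports.

Local Open Scope classical_set_scope.
Local Open Scope ring_scope.

(* The ascription to numClosedFieldType makes C carry the topology of its
   norm, the complex modulus; R[i] itself has no topological instance. *)
Definition C (R : realType) : numClosedFieldType := R[i].

Definition polynomial_mapping (R : realType) (n : nat) : Type :=
  n.-tuple (mpoly n (C R)).

Definition polymap (R : realType) (n : nat) (F : polynomial_mapping R n)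
    (x : 'rV[C R]_n) : 'rV[C R]_n :=
  \row_i meval (fun j => x 0 j) (tnth F i).

Definition proper_mapping (R : realType) (n : nat)
    (f : 'rV[C R]_n -> 'rV[C R]_n) : Prop :=
  continuous f /\
  forall K : set 'rV[C R]_n, compact K -> compact (f @^-1` K).

Definition jacobian_matrix (R : realType) (n : nat)
    (F : polynomial_mapping R n) (x : 'rV[C R]_n) : 'M[C R]_n :=
  \matrix_(i, j) meval (fun k => x 0 k) (mderiv j (tnth F i)).

Definition critical_point (R : realType) (n : nat)
    (F : polynomial_mapping R n) (x : 'rV[C R]_n) : Prop :=
  \det (jacobian_matrix F x) = 0.

Definition critical_value (R : realType) (n : nat)
    (F : polynomial_mapping R n) (y : 'rV[C R]_n) : Prop :=
  exists2 x, critical_point F x & polymap F x = y.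

(* mu(F) = d.  For proper F regular values exist and their fibers all have the
   same cardinality, so at most one d satisfies this. *)
Definition has_topological_degree (R : realType) (n : nat)
    (F : polynomial_mapping R n) (d : nat) : Prop :=
  forall y, ~ critical_value F y -> (polymap F @^-1` [set y] #= `I_d)%card.

Definition inverse_mappings (R : realType) (n : nat)
    (F G : polynomial_mapping R n) : Prop :=
  cancel (polymap F) (polymap G) /\ cancel (polymap G) (polymap F).

Definition polynomial_automorphism (R : realType) (n : nat)
    (F : polynomial_mapping R n) : Prop :=
  exists G, inverse_mappings F G.

Definition has_order_two (R : realType) (n : nat)
    (F : polynomial_mapping R n) : Prop :=
  polymap F \o polymap F =1 id /\ ~ (polymap F =1 id).

Definition linear_automorphism (R : realType) (n : nat)
    (f : 'rV[C R]_n -> 'rV[C R]_n) : Prop :=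
  exists2 A : 'M[C R]_n, A \in unitmx & forall x, f x = x *m A.

Definition linearization_conjecture (R : realType) (n : nat) : Prop :=
  forall Phi : polynomial_mapping R n,
    polynomial_automorphism Phi -> has_order_two Phi ->
    exists Psi PsiInv : polynomial_mapping R n,
      inverse_mappings Psi PsiInv /\
      linear_automorphism (polymap PsiInv \o polymap Phi \o polymap Psi).

Definition weakly_equivalent (R : realType) (n : nat)
    (F G : polynomial_mapping R n) : Prop :=
  exists Phi Psi : polynomial_mapping R n,
    [/\ polynomial_automorphism Phi, polynomial_automorphism Psi &
        polymap G =1 polymap Psi \o polymap F \o polymap Phi].

Definition square_first (R : realType) (n : nat) :
    polynomial_mapping R n.+1 :=
  [tuple let X := mpolyX (C R) (mnm1 i) in
         if i == ord0 then X ^+ 2 else X | i < n.+1].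

Lemma polymap_square_first (R : realType) (n : nat) (x : 'rV[C R]_n.+1) :
  polymap (square_first R n) x =
  \row_i (if i == ord0 then x 0 i ^+ 2 else x 0 i).
Proof.
apply/rowP => i; rewrite !mxE tnth_mktuple.
by case: ifP => _; rewrite ?mevalXn ?mevalXU //= rmorphXn /= mevalXU.
Qed.

(* Main.v *)
From HB Require Import structures.
Require Import Defs.
From mathcomp Require Import all_boot all_order all_algebra all_field.
From mathcomp Require Import complex.
From mathcomp Require Import -(notations) mpoly.
From mathcomp Require Import boolp classical_sets functions cardinality.
From mathcomp Require Import reals topology normedtype.
From mathcomp Require Import perm ring.

Set Implicit Arguments.
Unset Strict Implicit.
Unset Printing Implicit Defensive.

Import Order.TTheory GRing.Theory Num.Theory.
Import numFieldNormedType.Exports.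

Local Open Scope ring_scope.

Local Notation "''X_' i" := (mpolyX _ (mnm1 i)) : ring_scope.
Local Notation "p .@[ v ]" := (meval v p)
  (at level 2, format "p .@[ v ]") : ring_scope.
Local Notation "p \mPo F" := (comp_mpoly F p) (at level 50) : ring_scope.

(** Write [F] for the mapping, [x] for source and [y] for target coordinates.
    The idea is that a generic fiber has two points, that exchanging them is a
    polynomial involution, and that the conjecture makes this involution a
    reflection, whose invariants are the polynomials in [x_0 ^ 2] and the other
    variables.

    Every value is attained, since a value outside the image would be regular
    with an empty fiber; so composition with [F] embeds C[y] in C[x].  The
    coordinates are algebraic over C[y] by a dimension count, and the theorem of
    the primitive element gives one [z] that generates C(x) over C(y)
    ([primitive_element]).  Over a generic [y], the fiber is in bijection with
    the roots of the minimal relation of [z] ([fiber_point]).  The Jacobian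
    determinant divides a nonzero polynomial in [F], so a generic [y] is also
    a regular value; hence the relation has degree 2 ([size_minimal_relation])
    and, after completing the square, [z ^ 2] is a polynomial in [F].

    The field involution [z |-> - z] maps each coordinate to a quotient of
    polynomials.  Properness bounds this quotient over segments, and a polynomial
    [a] with [|a| <= M |b|] over each segment is a multiple of [b]
    ([mpoly_dvd_of_bounded]); therefore the involution is a polynomial mapping
    [Phi] with [F o Phi = F] ([deck_involution_exists]).  The same division shows
    that the polynomials invariant under [Phi] are the polynomials in [F]
    ([deck_invariant]).

    By the conjecture and diagonalization, [Phi] becomes a diagonal matrix of
    signs in suitable coordinates.  Its ring of invariants is generated by [n]
    elements, the components of [F]; counting point derivations at the origin,
    this leaves room for only one sign -1 ([unique_sign]).  The invariants are
    then generated as well by [x_0 ^ 2] and the other variables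
    ([even_polynomial]), and two systems of [n] generators of the same ring
    differ by a polynomial automorphism of the target. *)

(** * Polynomials in several variables *)

Section Mpoly.

Lemma mpoly_ring_ind (n : nat) (R : comNzRingType) (P : mpoly n R -> Prop) :
  (forall c, P (mpolyC n c)) -> (forall i, P 'X_i) ->
  (forall p q, P p -> P q -> P (p + q)) ->
  (forall p q, P p -> P q -> P (p * q)) -> forall p, P p.
Proof.
move=> PC PX PD PM; elim/mpolyind => [|c m p _ _ Pp]; first by rewrite -mpolyC0.
apply: (PD) => //; rewrite -mul_mpolyC; apply: (PM) => //.
rewrite mpolyXE_id; apply: big_rec => [|i q _ Pq]; first by rewrite -mpolyC1.
apply: (PM) => //; elim: (m i) => [|k IH]; first by rewrite expr0 -mpolyC1.
by rewrite exprS; apply: PM.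
Qed.

Lemma mmap_XU (n : nat) (R : nzRingType) (S : comNzRingType)
    (f : {rmorphism R -> S}) (h : 'I_n -> S) i :
  mmap f h 'X_i = h i.
Proof. by rewrite mmapX mmap1U. Qed.

Lemma meval_exp (n : nat) (R : comNzRingType) (v : 'I_n -> R) (p : mpoly n R)
    k :
  (p ^+ k).@[v] = p.@[v] ^+ k.
Proof. exact: (rmorphXn (meval v)). Qed.

Lemma muni_inj0 (n : nat) (R : nzRingType) (p : mpoly n.+1 R) :
  muni p = 0 -> p = 0.
Proof.
move=> p0; apply/mpolyP => m; rewrite mcoeff0; apply/eqP.
apply: contraT => pm; have mp : m \in msupp p by rewrite mcoeff_msupp.
pose r (k : multinom n.+1) : multinom n :=
  Multinom [tuple k (widen_ord (leqnSn n) i) | i < n].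
have rE (k k' : multinom n.+1) : r k = r k' -> k ord_max = k' ord_max -> k = k'.
  move=> rk km; apply/mnmP => i; case: (unliftP ord_max i) => [j|] ->//.
  have /mnmP/(_ j) := rk; rewrite !mnmE.
  suff -> : lift ord_max j = widen_ord (leqnSn n) j by [].
  by apply: val_inj; rewrite /= /bump leqNgt ltn_ord.
have : mcoeff (r m) ((muni p)`_(m ord_max)) = mcoeff m p.
  rewrite muniE coef_sum raddf_sum /= (bigD1_seq m) ?msupp_uniq //=.
  rewrite coefZ coefXn eqxx mulr1 mcoeffZ mcoeffX eqxx mulr1.
  rewrite big1 ?addr0 // => k km.
  rewrite coefZ coefXn; case: eqP => [e|_]; last by rewrite mulr0 mcoeff0.
  rewrite mulr1 mcoeffZ mcoeffX; case: eqP => [e'|_]; last by rewrite mulr0.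
  by case/eqP: km; apply: rE.
by rewrite p0 coef0 mcoeff0 => /esym/eqP; rewrite (negPf pm).
Qed.

Lemma muniX (n : nat) (R : comNzRingType) (i : 'I_n.+1) :
  muni ('X_i : mpoly n.+1 R) =
  if unlift ord_max i is Some j then ('X_j)%:P else 'X.
Proof.
rewrite muniE msuppX big_seq1 mcoeffX eqxx scale1r mnm1E.
case: unliftP => [j|] ->.
  have nj : lift ord_max j == ord_max = false by apply/negbTE;
    rewrite eq_sym neq_lift.
  rewrite nj expr0 -mul_polyC mulr1; congr (mpolyX _ _)%:P.
  by apply/mnmP => l; rewrite !mnmE -!val_eqE /= /bump leqNgt ltn_ord.
rewrite eqxx expr1 -mul_polyC.
set m := Multinom _; suff -> : m = @mnm0 n by rewrite mpolyX0 mul1r.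
by apply/mnmP => l; rewrite !mnmE -val_eqE /= gtn_eqF.
Qed.

Lemma poly_nonroot (R : idomainType) (p : {poly R}) (u : nat -> R) :
  p != 0 -> injective u -> exists k, p.[u k] != 0.
Proof.
move=> p0 iu; pose s := [seq u k | k <- iota 0 (size p)].
have us : uniq s by rewrite map_inj_uniq ?iota_uniq.
have : ~~ all (root p) s.
  apply/negP => /(max_poly_roots p0)/(_ us).
  by rewrite size_map size_iota ltnn.
by case/allPn => _ /mapP[k _ ->] /rootP/eqP pt; exists k.
Qed.

(** A nonzero polynomial over a field of characteristic zero is a nonzero
    function: specialize all variables but one away from the zeros of a leading
    coefficient. *)
Lemma mpoly_nonroot (K : numFieldType) (n : nat) (p : mpoly n K) :
  p != 0 -> exists v, p.@[v] != 0.
Proof.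
elim: n p => [|n IH] p p0.
  exists (fun=> 0); apply: contra_neq p0; rewrite {2}(mpolyE p) mevalE => p0.
  apply/mpolyP => m; rewrite mcoeff0 -[RHS]p0 raddf_sum /=.
  apply: eq_bigr => k _; rewrite big_ord0 mulr1 mcoeffZ mcoeffX.
  suff -> : k == m by rewrite mulr1.
  by apply/eqP/mnmP => -[].
have : lead_coef (muni p) != 0.
  by rewrite lead_coef_eq0; apply: contra_neq p0; apply: muni_inj0.
case/IH => v lv.
have q0 : map_poly (meval v) (muni p) != 0.
  by rewrite -size_poly_eq0 size_map_poly_id0 // size_poly_eq0 -lead_coef_eq0;
    apply: contra_neq lv => ->; rewrite meval0.
have [|k pt] := poly_nonroot (u := fun k => k%:R) q0.
  by move=> i j /eqP; rewrite eqr_nat => /eqP.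
set t := _%:R in pt; exists (fun i =>
  if unlift ord_max i is Some j then v j else t).
suff <- : (map_poly (meval v) (muni p)).[t] =
  p.@[fun i => if unlift ord_max i is Some j then v j else t] by [].
elim/mpoly_ring_ind: p {p0 lv q0 pt} => [c|i|p q IHp IHq|p q IHp IHq].
- by rewrite muniC map_polyC /= !mevalC hornerC.
- rewrite muniX mevalXU; case: unliftP => [j _|_].
    by rewrite map_polyC /= mevalXU hornerC.
  by rewrite map_polyX hornerX.
- by rewrite mevalD -IHp -IHq muniD (rmorphD (map_poly _)) hornerD.
- by rewrite mevalM -IHp -IHq muniM (rmorphM (map_poly _)) hornerM.
Qed.

Lemma mderivXU (n : nat) (R : nzRingType) (i j : 'I_n) :
  mderiv i ('X_j : mpoly n R) = mpolyC n (j == i)%:R.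
Proof.
rewrite mderivX mnm1E; case: eqP => [->|_]; last by rewrite scale0r mpolyC0.
rewrite scale1r mpolyC1 -mpolyX0; congr (mpolyX _ _).
by apply/mnmP => k; rewrite mnmBE subnn mnm0E.
Qed.

Lemma comp_mpoly_deriv (n k : nat) (R : comNzRingType)
    (F : n.-tuple (mpoly k R)) (i : 'I_k) (p : mpoly n R) :
  mderiv i (p \mPo F) =
  \sum_j (mderiv j p \mPo F) * mderiv i (tnth F j).
Proof.
elim/mpoly_ring_ind: p => [c|j|p q IHp IHq|p q IHp IHq].
- rewrite comp_mpolyC mderivC big1 // => j _.
  by rewrite mderivC comp_mpoly0 mul0r.
- rewrite (bigD1 j) //= big1 => [|l lj]; rewrite mderivXU.
    by rewrite eqxx comp_mpolyC mpolyC1 mul1r addr0 comp_mpolyXU -tnth_nth.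
  by rewrite eq_sym (negPf lj) comp_mpolyC mpolyC0 mul0r.
- rewrite comp_mpolyD mderivD IHp IHq -big_split; apply: eq_bigr => j _ /=.
  by rewrite mderivD comp_mpolyD mulrDl.
- rewrite rmorphM mderivM IHp IHq mulr_suml mulr_sumr -big_split.
  apply: eq_bigr => j _ /=.
  rewrite mderivM comp_mpolyD !rmorphM /=; ring.
Qed.

Lemma meval_bound (K : numDomainType) (n : nat) (p : mpoly n K) (M : K) :
  exists B, forall v, (forall i, `|v i| <= M) -> `|p.@[v]| <= B.
Proof.
elim/mpoly_ring_ind: p => [c|j|p q [P IHp] [Q IHq]|p q [P IHp] [Q IHq]].
- by exists `|c| => v _; rewrite mevalC.
- by exists M => v; rewrite mevalXU.
- exists (P + Q) => v vM; rewrite mevalD.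
  by apply: (le_trans (ler_normD _ _)); rewrite lerD ?IHp ?IHq.
- by exists (P * Q) => v vM; rewrite mevalM normrM ler_pM ?IHp ?IHq.
Qed.

End Mpoly.

(** * Divisibility from bounds *)

Section Division.

Variable K : numClosedFieldType.

(** A root [z] of [b] is a root of [r], as [b] tends to 0 at [z]; dividing both
    by [X - z] keeps the bound, except at [z] itself.  The multiple [e] of the
    initial [b] excludes these points once and for all. *)
Lemma poly_dvd_of_bounded_off (e b r : {poly K}) :
  e != 0 -> b != 0 -> {subset root b <= root e} ->
  (forall z, exists2 M : K, 0 <= M & forall s : K, 0 < s -> s <= 1 ->
     e.[z + s] != 0 -> `|r.[z + s]| <= M * `|b.[z + s]|) ->
  b %| r.
Proof.
move=> e0; move: {2}(size b) (leqnn (size b)) => k.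
elim: k b r => [|k IH] b r.
  by rewrite leqn0 size_poly_eq0 => /eqP->; rewrite eqxx.
have [/eqP|sb1] := eqVneq (size b) 1%N.
  by rewrite size_poly_eq1 => /eqp_dvdl -> _ _ _ _; exact: dvd1p.
have /closed_rootP[z bz] := sb1.
have /factor_theorem[b1 Db] := bz => sb b0 rb bnd.
have b10 : b1 != 0 by apply: contra_neq b0; rewrite Db => ->; rewrite mul0r.
have rz : r.[z] = 0.
  have [r1 Dr] : exists r1, r - (r.[z])%:P = r1 * ('X - z%:P).
    by apply/factor_theorem; rewrite /root hornerD hornerN hornerC subrr.
  have [M M0 HM] := bnd z.
  have [B HB] := poly_disk_bound b1 (`|z| + 1).
  have [B' HB'] := poly_disk_bound r1 (`|z| + 1).
  have ge0 p C : (forall x, `|x| <= `|z| + 1 -> `|p.[x]| <= C) -> 0 <= C.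
    by move=> /(_ z); rewrite lerDl ler01 => /(_ isT); apply: le_trans.
  have C0 : 0 <= M * B + B' by rewrite addr_ge0 ?mulr_ge0 // ?(ge0 _ _ HB)
    ?(ge0 _ _ HB').
  have zsz s : z + s - z = s by rewrite addrC addKr.
  have est s : 0 < s -> s <= 1 -> e.[z + s] != 0 ->
      `|r.[z]| <= (M * B + B') * s.
    move=> s0 s1 es.
    have zs : `|z + s| <= `|z| + 1.
      by apply: (le_trans (ler_normD _ _)); rewrite lerD2l gtr0_norm.
    have ->: r.[z] = r.[z + s] - r1.[z + s] * s.
      have /(congr1 (fun p => p.[z + s])) := Dr.
      by rewrite hornerD hornerN hornerC hornerM hornerXsubC zsz => <-;
        rewrite subKr.
    apply: (le_trans (ler_normB _ _)); rewrite mulrDl lerD //.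
      apply: (le_trans (HM _ s0 s1 es)).
      rewrite Db hornerM hornerXsubC zsz normrM (gtr0_norm s0).
      by rewrite -mulrA ler_wpM2l // ler_wpM2r ?(ltW s0) // HB.
    by rewrite normrM (gtr0_norm s0) ler_wpM2r ?(ltW s0) // HB'.
  apply/eqP; apply: contraT => nrz.
  have nrz0 : 0 < `|r.[z]| by rewrite normr_gt0.
  set C := M * B + B' in est C0.
  pose d := `|r.[z]| + 1 + C.
  have d0 : 0 < d by rewrite /d ltr_wpDr // ltr_wpDr.
  (* There are infinitely many [s j], so [e] is nonzero at one of the
     [z + s j]; each [s j] is small enough to contradict [est]. *)
  pose s j : K := `|r.[z]| / d / j.+1%:R.
  have s0 j : 0 < s j by rewrite !divr_gt0 // ltr0n.
  have sle j : s j <= `|r.[z]| / d.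
    by rewrite ler_pdivrMr ?ltr0n // ler_peMr ?divr_ge0 ?ler1n // ltW.
  have s1 : `|r.[z]| / d <= 1.
    by rewrite ler_pdivrMr // mul1r /d -addrA lerDl addr_ge0.
  have [j ej] : exists j, e.[z + s j] != 0.
    apply: (poly_nonroot (u := fun j => z + s j) e0) => i j /addrI.
    rewrite /s => /mulfI; rewrite mulf_neq0 ?invr_eq0 ?gt_eqF // => /(_ isT).
    by move=> /invr_inj/eqP; rewrite eqr_nat => /eqP[].
  have := est _ (s0 j) (le_trans (sle j) s1) ej.
  have lt : C * (`|r.[z]| / d) < `|r.[z]|.
    rewrite mulrCA gtr_pMr // ltr_pdivrMr // mul1r /d addrC ltrDl.
    by rewrite ltr_wpDr.
  move=> /le_lt_trans/(_ (le_lt_trans _ lt)); rewrite ltxx; apply.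
  by rewrite ler_wpM2l.
have /factor_theorem[r1 Dr] : root r z by rewrite /root rz.
rewrite {1}Db {1}Dr dvdp_mul2r; last by rewrite polyXsubC_eq0.
apply: IH => //.
- by rewrite -ltnS (leq_trans _ sb) // Db size_Mmonic ?monicXsubC // size_XsubC
  addn2.
- by move=> x b1x; apply: rb; rewrite -topredE /= Db rootM; apply/orP; left.
move=> w; have [M M0 HM] := bnd w; exists M => // s s0 s1 es.
have := HM _ s0 s1 es; rewrite Db Dr !hornerM !normrM mulrA ler_pM2r //.
rewrite normr_gt0 !hornerE subr_eq0; apply: contraNneq es => ->.
by have /rootP-> := rb _ bz.
Qed.

Lemma poly_dvd_of_bounded (b r : {poly K}) :
  b != 0 ->
  (forall z, exists2 M : K, 0 <= M & forall s : K, 0 < s -> s <= 1 ->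
     b.[z + s] != 0 -> `|r.[z + s]| <= M * `|b.[z + s]|) ->
  b %| r.
Proof. by move=> b0; apply: poly_dvd_of_bounded_off. Qed.

(** The polynomial [p (y + T v)] in [T], whose coefficients are polynomials in
    [y]: the restrictions of [p] to all the lines of direction [v] at once. *)
Definition translate (n : nat) (v : 'I_n -> K) (p : mpoly n K) :
    {poly mpoly n K} :=
  mmap (polyC \o @mpolyC n K)
    (fun i => ('X_i)%:P + (mpolyC n (v i)) *: 'X) p.

HB.instance Definition _ n v := GRing.RMorphism.copy (@translate n v)
  (mmap (polyC \o @mpolyC n K)
    (fun i => ('X_i)%:P + (mpolyC n (v i)) *: 'X)).

Lemma translateC n v c : translate v (mpolyC n c) = (mpolyC n c)%:P.
Proof. by rewrite /translate mmapC. Qed.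

Lemma translateX n v i :
  @translate n v 'X_i = ('X_i)%:P + mpolyC n (v i) *: 'X.
Proof. by rewrite /translate mmap_XU. Qed.

Lemma translateE n v (p : mpoly n K) y t :
  (map_poly (meval y) (translate v p)).[t] = p.@[fun i => y i + t * v i].
Proof.
elim/mpoly_ring_ind: p => [c|i|p q IHp IHq|p q IHp IHq].
- by rewrite translateC map_polyC /= !mevalC hornerC.
- rewrite translateX rmorphD /= map_polyC map_polyZ /= map_polyX.
  by rewrite !mevalXU mevalC !hornerE mulrC.
- by rewrite mevalD -IHp -IHq (rmorphD (translate v)) (rmorphD (map_poly _))
  hornerD.
- by rewrite mevalM -IHp -IHq (rmorphM (translate v)) (rmorphM (map_poly _))
  hornerM.
Qed.

Lemma translate0 n v (p : mpoly n K) : (translate v p).[0] = p.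
Proof.
elim/mpoly_ring_ind: p => [c|i|p q IHp IHq|p q IHp IHq].
- by rewrite translateC hornerC.
- by rewrite translateX !hornerE.
- by rewrite -{2}IHp -{2}IHq (rmorphD (translate v)) hornerD.
- by rewrite -{2}IHp -{2}IHq (rmorphM (translate v)) hornerM.
Qed.

Lemma translate_mnm n v (m : multinom n) :
  (size (translate v (mpolyX K m)) <= (mdeg m).+1)%N /\
  (translate v (mpolyX K m))`_(mdeg m) = mpolyC n (\prod_i v i ^+ m i).
Proof.
have mul (p q : {poly mpoly n K}) a b c d :
    (size p <= a.+1)%N /\ p`_a = c -> (size q <= b.+1)%N /\ q`_b = d ->
    (size (p * q)%R <= (a + b).+1)%N /\ (p * q)`_(a + b) = c * d.
  move=> [sp pa] [sq qb]; split.
    apply: (leq_trans (size_polyMleq _ _)).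
    by rewrite -subn1 leq_subLR add1n -addSn -addnS leq_add.
  rewrite coefM (bigD1 (Ordinal (leq_addr b a : a < (a + b).+1)%N)) //=.
  rewrite addKn pa qb big1 ?addr0 // => -[i /= ile] /eqP ia.
  have {ia} : i != a by apply/eqP => e; apply: ia; apply: val_inj.
  rewrite neq_ltn => /orP[ia|ai].
    rewrite [q`__]nth_default ?mulr0 // (leq_trans sq) //.
    by rewrite ltn_subRL ltn_add2r.
  by rewrite [p`__]nth_default ?mul0r // (leq_trans sp).
rewrite /translate mmapX /mmap1 mdegE rmorph_prod.
elim/big_rec3: _ => [|i a d p _ IH].
  by rewrite size_poly1 coef1.
rewrite rmorphXn /=; apply: (mul) => //.
elim: (m i) => [|k IHk]; first by rewrite !expr0 size_poly1 coef1.
rewrite !exprS; apply: (mul _ _ 1%N k) => //; split.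
  apply: (leq_trans (size_polyD _ _)); rewrite geq_max.
  rewrite (leq_trans (size_polyC_leq1 _)) // (leq_trans (size_scale_leq _ _))
    //.
  by rewrite size_polyX.
by rewrite coefD coefC coefZ coefX add0r mulr1.
Qed.

(** For [v] outside the zeros of the homogeneous part of [p] of highest degree,
    the restriction of [p] to every line of direction [v] has the same leading
    coefficient. *)
Lemma lead_coef_translate n (p : mpoly n K) :
  p != 0 ->
  exists v, exists2 c, c != 0 & lead_coef (translate v p) = mpolyC n c.
Proof.
move=> p0; pose d := (msize p).-1.
have dE : msize p = d.+1 by rewrite mpolySpred.
pose top := \sum_(m <- msupp p | mdeg m == d) mcoeff m p *: mpolyX K m.
have top0 : top != 0.
  apply: contraTneq (mlead_supp p0) => /(congr1 (mcoeff (mlead p))).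
  rewrite mcoeff0 raddf_sum /= -big_filter.
  rewrite (bigD1_seq (mlead p)) ?filter_uniq ?msupp_uniq //=; last first.
    by rewrite mem_filter mlead_supp // andbT -eqSS mlead_deg // -dE.
  rewrite mcoeffZ mcoeffX eqxx mulr1 big1 => [|m /negPf ml].
    by rewrite addr0 mcoeff_msupp => ->; rewrite eqxx.
  by rewrite mcoeffZ mcoeffX ml mulr0.
have [v tv] := mpoly_nonroot top0; exists v, top.@[v] => //.
have tE : translate v p =
    \sum_(m <- msupp p) mpolyC n (mcoeff m p) *: translate v (mpolyX K m).
  rewrite {1}(mpolyE p) rmorph_sum; apply: eq_bigr => m _.
  by rewrite -mul_mpolyC (rmorphM (translate v)) /= translateC mul_polyC.
have st : (size (translate v p) <= d.+1)%N.
  rewrite tE; apply: (leq_trans (size_sum _ _ _)).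
  apply/bigmax_leqP_seq => m mp _.
  apply: (leq_trans (size_scale_leq _ _)).
  by apply: (leq_trans (translate_mnm v m).1); rewrite -dE msize_mdeg_lt.
have ct : (translate v p)`_d = mpolyC n (top.@[v]).
  rewrite tE coef_sum /top (raddf_sum (meval v)) (raddf_sum (@mpolyC n K)) /=.
  rewrite [RHS]big_mkcond /=.
  rewrite big_seq [RHS]big_seq; apply: eq_bigr => m mp.
  rewrite coefZ mevalZ mevalX; have [s c] := translate_mnm v m.
  case: eqP => [<-|/eqP md]; first by rewrite c mpolyCM.
  rewrite nth_default ?mulr0 // (leq_trans s) //.
  by rewrite ltn_neqAle md -ltnS -dE msize_mdeg_lt.
rewrite -ct lead_coefE; congr (_`__); apply: succn_inj.
rewrite -dE -polySpred; first apply/eqP; last first.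
  by apply: contraNneq tv => t0; rewrite -(mpolyC_eq0 n) -ct t0 coef0.
rewrite eqn_leq dE st ltnNge; apply: contraNN tv => sd.
by rewrite -(mpolyC_eq0 n) -ct nth_default.
Qed.

(** In a direction where the restrictions of [b] have a constant leading
    coefficient, divide [a] by [b] with remainder on all lines at once.  On each
    line the remainder is divisible by [b] by the case of one variable, so it
    vanishes. *)
Lemma mpoly_dvd_of_bounded (n : nat) (a b : mpoly n K) :
  b != 0 ->
  (forall y v : 'I_n -> K,
     exists2 M : K, 0 <= M & forall s : K, 0 < s -> s <= 1 ->
     b.@[fun i => y i + s * v i] != 0 ->
     `|a.@[fun i => y i + s * v i]| <= M * `|b.@[fun i => y i + s * v i]|) ->
  exists c, a = c * b.
Proof.
move=> b0 bnd; have [v [c c0]] := lead_coef_translate b0.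
move: (translate v a) (translateE v a) (translate0 v a) => ta Ea Ea0.
move: (translate v b) (translateE v b) (translate0 v b) => tb Eb Eb0 lb.
have ub : lead_coef tb \is a GRing.unit by rewrite lb rmorph_unit // unitfE.
have tb0 : tb != 0 by rewrite -lead_coef_eq0 lb mpolyC_eq0.
have := Pdiv.IdomainUnit.divp_eq ub ta.
set q := _ %/ _; set r := _ %% _ => Da.
suff r0 : r = 0.
  by exists q.[0]; rewrite -Ea0 Da r0 addr0 hornerM Eb0.
apply/polyP => i; rewrite coef0; apply/eqP; apply: contraT => /mpoly_nonroot[y].
have : map_poly (meval y) r = 0; last first.
  by move=> /(congr1 (fun p : {poly K} => p`_i));
    rewrite coef_map coef0 /= => ->; rewrite eqxx.
have lby : (meval y) (lead_coef tb) != 0 by rewrite lb /= mevalC.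
apply/eqP; apply: contraT => ry0.
have : map_poly (meval y) tb %| map_poly (meval y) r.
  have -> : r = ta - q * tb by rewrite Da addrC addKr.
  rewrite (rmorphB (map_poly _)) (rmorphM (map_poly _)).
  apply: dvdp_sub; last exact: dvdp_mulIr.
  apply: poly_dvd_of_bounded => [|z].
    by rewrite -size_poly_eq0 size_map_poly_id0 // size_poly_eq0.
  have [M M0 HM] := bnd (fun i => y i + z * v i) v; exists M => // s s0 s1.
  have E p : p.@[fun i => y i + (z + s) * v i] = p.@[fun i =>
    y i + z * v i + s * v i].
    by apply: meval_eq => j; rewrite mulrDl addrA.
  by rewrite Ea Eb (E b) (E a); exact: HM.
move=> /(dvdp_leq ry0); rewrite size_map_poly_id0 // leqNgt.
by rewrite (leq_ltn_trans (size_poly _ _)) // ltn_modp.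
Qed.

End Division.

(** * Algebraic dependence over the components of a mapping *)

Lemma linear_dependence (K : fieldType) (I J : finType) (M : I -> J -> K) :
  (#|J| < #|I|)%N ->
  exists2 c : I -> K, (exists i, c i != 0) & forall j, \sum_i c i * M i j = 0.
Proof.
move=> lt; pose A := \matrix_(i < #|I|, j < #|J|) M (enum_val i) (enum_val j).
have : kermx A != 0.
  rewrite kermx_eq0 /row_free; apply: contraTneq lt => rA; rewrite -leqNgt -rA.
  exact: rank_leq_col.
case/rowV0Pn => v /sub_kermxP vA v0.
exists (fun i => v 0 (enum_rank i)) => [|j].
  apply: contrapT => /forallNP H; case/eqP: v0; apply/rowP => i; rewrite mxE.
  by have /negP := H (enum_val i); rewrite enum_valK negbK => /eqP.
have /rowP/(_ (enum_rank j)) := vA; rewrite !mxE => vAj.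
apply: etrans vAj; rewrite (reindex (@enum_val I I)) /=; last first.
  by apply: onW_bij; exact: enum_val_bij.
by apply: eq_bigr => i _; rewrite enum_valK !mxE enum_rankK.
Qed.

Section Dependence.

Variables (K : numClosedFieldType) (n : nat).

Lemma msize_mul_leS (p q : mpoly n K) a b :
  (msize p <= a.+1)%N -> (msize q <= b.+1)%N -> (msize (p * q)%R <= (a +
    b).+1)%N.
Proof.
have [->|p0] := eqVneq p 0; first by rewrite mul0r msize0.
have [->|q0] := eqVneq q 0; first by rewrite mulr0 msize0.
by move=> pa qb; rewrite msizeM // -subn1 leq_subLR add1n -addSn -addnS leq_add.
Qed.

Lemma msize_exp_leS (p : mpoly n K) a k :
  (msize p <= a.+1)%N -> (msize (p ^+ k)%R <= (k * a).+1)%N.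
Proof.
move=> pa; elim: k => [|k IH]; first by rewrite expr0 msize1.
by rewrite exprS mulSn msize_mul_leS.
Qed.

(** The monomials of degree at most [d] have all their exponents at most [d],
    so there are at most [d.+1 ^ n] of them. *)
Lemma mpoly_linear_dependence (I : finType) (p : I -> mpoly n K) d :
  (forall i, msize (p i) <= d.+1)%N -> (d.+1 ^ n < #|I|)%N ->
  exists2 c : I -> K, (exists i, c i != 0) & \sum_i c i *: p i = 0.
Proof.
move=> sp; pose J : finType := {ffun 'I_n -> 'I_d.+1}.
have -> : (d.+1 ^ n = #|J|)%N by rewrite card_ffun !card_ord.
pose mon (j : J) : multinom n := Multinom [tuple (j i : nat) | i < n].
case/(linear_dependence (fun i j => mcoeff (mon j) (p i))) => c c0 E;
  exists c => //.
apply/mpolyP => m; rewrite mcoeff0 raddf_sum /=.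
have [md|/existsNP[i /negP]] := pselect (forall i, (m i < d.+1)%N); last first.
  rewrite -leqNgt => dm.
  apply: big1 => j _; rewrite mcoeffZ (memN_msupp_eq0 (m := m)) ?mulr0 //.
  apply: contraTN dm => /msize_mdeg_lt mp; rewrite -ltnNge.
  apply: leq_trans (sp j); apply: leq_ltn_trans mp.
  by rewrite mdegE (bigD1 i) //= leq_addr.
have jm : mon [ffun i => Ordinal (md i)] = m by apply/mnmP => i;
  rewrite mnmE ffunE.
by rewrite -[RHS](E [ffun i => Ordinal (md i)]); apply: eq_bigr => i _;
  rewrite mcoeffZ jm.
Qed.

Variable F : n.-tuple (mpoly n K).

(** Polynomials [G] over the ring of target coordinates stand for relations
    of [w] over the ring of polynomials in [F]; this keeps most of the argument
    free of fractions. *)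
Definition ev (w : mpoly n K) (G : {poly mpoly n K}) : mpoly n K :=
  (map_poly (comp_mpoly F) G).[w].

HB.instance Definition _ w := GRing.RMorphism.copy (ev w)
  (horner_eval w \o map_poly (comp_mpoly F)).

Lemma ev0 w : ev w 0 = 0. Proof. exact: (rmorph0 (ev w)). Qed.

Lemma evD w : {morph ev w : G H / G + H}.
Proof. exact: (rmorphD (ev w)). Qed.

Lemma evB w : {morph ev w : G H / G - H}.
Proof. exact: (rmorphB (ev w)). Qed.

Lemma evM w : {morph ev w : G H / G * H}.
Proof. exact: (rmorphM (ev w)). Qed.

Lemma evC w c : ev w c%:P = c \mPo F.
Proof. by rewrite /ev map_polyC hornerC. Qed.

Lemma evX w : ev w 'X = w.
Proof. by rewrite /ev map_polyX hornerX. Qed.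

Lemma evZ w c G : ev w (c *: G) = (c \mPo F) * ev w G.
Proof. by rewrite -mul_polyC evM evC. Qed.

(** There are [m ^ n.+1] monomials of degree less than [m] in each of [n + 1]
    variables, while their images have degree O([m]) and so span a space of
    dimension O([m ^ n]). *)
Lemma ev_dependent w : exists2 G, G != 0 & ev w G = 0.
Proof.
pose e := maxn (msize w) (\max_i msize (tnth F i)).
pose c := ((n * e + e).+1)%N; pose m := (c ^ n).+1.
pose I : finType := ({ffun 'I_n -> 'I_m} * 'I_m)%type.
pose mon (i : I) : multinom n := Multinom [tuple (i.1 j : nat) | j < n].
pose p (i : I) := (mpolyX K (mon i) \mPo F) * w ^+ i.2.
have sF j : (msize (tnth F j) <= e.+1)%N.
  by rewrite (leq_trans _ (leqnSn e)) // leq_max orbC (leq_bigmax j).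
have sw : (msize w <= e.+1)%N by rewrite (leq_trans _ (leqnSn e)) // leq_maxl.
have sp i : (msize (p i) <= ((n * e + e) * m).+1)%N.
  rewrite mulnDl; apply: msize_mul_leS; last first.
    apply: (leq_trans (msize_exp_leS _ sw)).
    by rewrite ltnS mulnC leq_mul2l ltnW ?orbT.
  have -> : (n * e * m = \sum_(j < n) e * m)%N.
    by rewrite sum_nat_const card_ord mulnA.
  rewrite comp_mpolyX.
  elim/big_rec2: _ => [|j k q _ IH]; first by rewrite msize1.
  apply: msize_mul_leS => //; apply: (leq_trans (msize_exp_leS _ (sF j))).
  by rewrite ltnS mulnC leq_mul2l mnmE ltnW ?orbT.
have lt : (((n * e + e) * m).+1 ^ n < #|I|)%N.
  rewrite card_prod card_ffun !card_ord.
  apply: (@leq_ltn_trans ((c * m) ^ n)).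
    have mono a b k : (a <= b)%N -> (a ^ k <= b ^ k)%N.
      by case: k => // k ab; rewrite leq_exp2r.
    by apply: mono; rewrite /c mulSn -add1n leq_add2r.
  by rewrite expnMn mulnC ltn_pmul2l // expn_gt0.
have [v [i vi] pv] := mpoly_linear_dependence sp lt.
exists (\sum_i (v i *: mpolyX K (mon i)) *: 'X^(i.2)).
  apply: contra_neq vi => /(congr1 (fun q : {poly mpoly n K} =>
    mcoeff (mon i) q`_(i.2))).
  rewrite coef0 mcoeff0 coef_sum raddf_sum /= (bigD1 i) //=.
  rewrite coefZ coefXn eqxx mulr1 mcoeffZ mcoeffX eqxx mulr1 big1 ?addr0 // =>
    j ji.
  rewrite coefZ coefXn; case: eqP => [e2|_]; last by rewrite mulr0 mcoeff0.
  rewrite mulr1 mcoeffZ mcoeffX; case: eqP => [e1|_]; last by rewrite mulr0.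
  case/eqP: ji; case: i j e1 e2 => [i1 i2] [j1 j2] e1 /= /val_inj ->.
  congr (_, _); apply/ffunP => k; apply: val_inj.
  by have /mnmP/(_ k) := e1; rewrite !mnmE.
rewrite (rmorph_sum (ev w)) -[RHS]pv; apply: eq_bigr => j _ /=.
by rewrite evZ (rmorphXn (ev w)) /= evX comp_mpolyZ scalerAl.
Qed.

(** [P] generates, up to denominators, the relations of [w] over the ring of
    polynomials in [F]: it is the minimal polynomial of [w] over the fraction
    field of that ring, with its denominators cleared. *)
Definition minimal_relation w P :=
  [/\ P != 0, ev w P = 0 &
    forall H, ev w H = 0 -> (size H < size P)%N -> H = 0].

Lemma minimal_relation_exists w : exists P, minimal_relation w P.
Proof.
pose good k := `[< exists G, [/\ G != 0, ev w G = 0 & size G = k] >].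
have ex : exists k, good k.
  by have [G G0 wG] := ev_dependent w; exists (size G); apply/asboolP; exists G.
case: (ex_minnP ex) => k /asboolP[P [P0 wP sP]] min; exists P; split=> // H wH.
rewrite sP; apply: contraTeq => H0; rewrite -leqNgt; apply: min.
by apply/asboolP; exists H.
Qed.

Lemma minimal_relation_dvd w P H :
  minimal_relation w P -> ev w H = 0 ->
  exists k S, lead_coef P ^+ k *: H = S * P.
Proof.
move=> [P0 wP min] wH; have := Pdiv.Idomain.divp_eq H P.
set k := Pdiv.Idomain.scalp _ _ => E; exists k, (H %/ P).
suff r0 : H %% P = 0 by rewrite E r0 addr0.
apply: min; last by rewrite ltn_modp.
have := congr1 (ev w) E.
by rewrite evZ wH mulr0 evD evM wP mulr0 add0r.
Qed.

Hypothesis F_inj : forall p : mpoly n K, p \mPo F = 0 -> p = 0.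

Lemma comp_neq0 (p : mpoly n K) : p != 0 -> p \mPo F != 0.
Proof. by apply: contra_neq; apply: F_inj. Qed.

Lemma minimal_relation_size w P : minimal_relation w P -> (1 < size P)%N.
Proof.
move=> [P0 wP _]; rewrite ltnNge; apply: contra P0 => sP.
by move: wP; rewrite (size1_polyC sP) evC => /F_inj ->.
Qed.

Lemma minimal_relation_separable w P : minimal_relation w P -> ev w P^`() != 0.
Proof.
move=> mP; have [P0 wP min] := mP; have s1 := minimal_relation_size mP.
apply/eqP => /min; rewrite lt_size_deriv // =>
  /(_ isT) /(congr1 (fun q : {poly mpoly n K} => q`_(size P).-2)).
case: (size P) s1 (lead_coefE P) => [|[|k]] //= _ lP.
rewrite coef0 coef_deriv -lP -mulr_natl => /eqP;
  rewrite mulf_eq0 lead_coef_eq0 (negPf P0) orbF.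
by rewrite -(rmorph_nat (@mpolyC n K)) mpolyC_eq0 pnatr_eq0.
Qed.

(** [w] divides the constant coefficient of its minimal relation, which is not
    zero by minimality. *)
Lemma dvd_comp w : w != 0 -> exists2 E, E != 0 & exists v, E \mPo F = w * v.
Proof.
move=> w0; have [P mP] := minimal_relation_exists w; have [P0 wP min] := mP.
have [Q DQ] : exists Q, P - (P`_0)%:P = Q * 'X.
  have /factor_theorem[Q ->] : root (P - (P`_0)%:P) 0.
    by rewrite /root hornerD hornerN hornerC horner_coef0 subrr.
  by exists Q; congr (_ * _); rewrite polyC0 subr0.
have EQ : ev w Q * w = - (P`_0 \mPo F).
  have := congr1 (ev w) DQ.
  by rewrite evB evM wP evC evX sub0r => ->.
exists P`_0; last by exists (- ev w Q); rewrite mulrN mulrC EQ opprK.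
apply/eqP => c0; case/eqP: P0.
move: DQ EQ; rewrite c0 polyC0 comp_mpoly0 subr0 oppr0 => DP /eqP.
rewrite mulf_eq0 (negPf w0) orbF => /eqP /min Q0.
have [Q0'|nQ0] := eqVneq Q 0; first by rewrite DP Q0' mul0r.
by rewrite DP Q0 ?mul0r // DP size_mulX.
Qed.

Lemma mderiv_ev w G k :
  mderiv k (ev w G) =
  \sum_j ev w (map_poly (mderiv j) G) * mderiv k (tnth F j) + ev w G^`() *
    mderiv k w.
Proof.
elim/poly_ind: G => [|G c IH].
  rewrite big1 ?add0r => [|j _].
    by rewrite deriv0 ev0 mderiv0 mul0r.
  by rewrite map_poly0 ev0 mul0r.
rewrite derivD derivC addr0 derivM derivX mulr1 !evD !evM evX evC.
rewrite mderivD mderivM IH comp_mpoly_deriv.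
rewrite [X in _ = X + _](eq_bigr (fun j => 
  ev w (map_poly (mderiv j) G) * mderiv k (tnth F j) * w + (mderiv j c \mPo F)
    * mderiv k (tnth F j))).
  rewrite big_split /= -mulr_suml; ring.
move=> j _; rewrite (raddfD (map_poly _)) /= map_polyC /= evD evC mulrDl;
  congr (_ + _).
suff -> : map_poly (mderiv j) (G * 'X) = map_poly (mderiv j) G * 'X.
  by rewrite evM evX mulrAC.
by apply/polyP => i; rewrite coef_map !coefMX; case: i => [|i] /=;
  rewrite ?mderiv0 ?coef_map.
Qed.

Definition jacobian : 'M[mpoly n K]_n := \matrix_(i, j) mderiv j (tnth F i).

(** Differentiating the minimal relations of the variables expresses a diagonal
    matrix with nonzero entries as a multiple of the Jacobian matrix. *)
Lemma det_jacobian_neq0 : \det jacobian != 0.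
Proof.
have [P mP] := choice (fun i => minimal_relation_exists ('X_i : mpoly n K)).
pose M : 'M[mpoly n K]_n := \matrix_(i, j) ev 'X_i (map_poly (mderiv j) (P i)).
pose d : 'rV[mpoly n K]_n := \row_i - ev 'X_i (P i)^`().
have /(congr1 (fun A => \det A)) : M *m jacobian = diag_mx d.
  apply/matrixP => i k; rewrite !mxE.
  have [_ wP _] := mP i; have := mderiv_ev 'X_i (P i) k.
  rewrite wP mderiv0 mderivXU => /esym/eqP; rewrite addr_eq0 => /eqP.
  move=> E; under eq_bigr do rewrite !mxE.
  rewrite E -mulNr; case: eqP => _; last by rewrite mpolyC0 mulr0.
  by rewrite mpolyC1 mulr1.
rewrite det_mulmx det_diag => dE; apply: contraTneq isT => J0; move: dE.
rewrite J0 mulr0 => /esym/eqP; rewrite prodf_seq_eq0 => /hasP[i _] /=.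
by rewrite mxE oppr_eq0 (negPf (minimal_relation_separable (mP i))).
Qed.

End Dependence.

(** * Primitive elements *)

Section FractionMap.

Local Notation "x %:F" := (@FracField.tofrac _ x).

Lemma fractionP (R : idomainType) (x : {fraction R}) :
  exists n d, d != 0 /\ x = n%:F / d%:F.
Proof.
elim/quotW: x => -[[n d] /= d0]; exists n, d; split=> //.
rewrite !piE; apply/eqmodP; rewrite /= FracField.equivfE.
rewrite /FracField.mulf /FracField.invf /=.
by rewrite !numden_Ratio ?oner_eq0 ?mul1r ?mulr1 // mulrC.
Qed.

Lemma fraction_clear_denominators (R : idomainType) (q : {poly {fraction R}}) :
  exists2 d, d != 0 & exists Q : {poly R}, d%:F *: q = map_poly
    (@FracField.tofrac R) Q.
Proof.
elim/poly_ind: q => [|q c [d d0 [Q DQ]]].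
  by exists 1; rewrite ?oner_eq0 //; exists 0; rewrite scaler0 rmorph0.
have [n [e [e0 ->]]] := fractionP c.
exists (e * d); first by rewrite mulf_neq0.
exists (e *: Q * 'X + (d * n)%:P).
rewrite (rmorphD (map_poly _)) (rmorphM (map_poly _)) /= map_polyZ /= map_polyX
  map_polyC /= -DQ.
rewrite scalerDr scalerAl scalerA -tofracM; congr (_ + _).
rewrite -mul_polyC -polyCM; congr (_%:P).
by rewrite !tofracM [_ * d%:F]mulrC -mulrA (mulrCA e%:F) divff ?tofrac_eq0
  ?mulr1.
Qed.

Variables (A B : idomainType) (f : {rmorphism A -> B}).
Hypothesis f_inj : forall a, f a = 0 -> a = 0.

Let fn0 d : d != 0 -> (f d)%:F != 0.
Proof. by rewrite tofrac_eq0; apply: contra_neq; apply: f_inj. Qed.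

Lemma fraction_map_exists : exists h : {fraction A} -> {fraction B},
  forall n d, d != 0 -> h (n%:F / d%:F) = (f n)%:F / (f d)%:F.
Proof.
suff /choice[h hE] : forall x, exists y, forall n d, d != 0 -> x = n%:F / d%:F
  ->
    y = (f n)%:F / (f d)%:F.
  by exists h => n d d0; apply: hE.
move=> x; have [n [d [d0 ->]]] := fractionP x.
exists ((f n)%:F / (f d)%:F) => n' d' d'0 /eqP.
rewrite eqr_div ?tofrac_eq0 // -!tofracM tofrac_eq => /eqP E.
by apply/eqP; rewrite eqr_div ?fn0 // -!tofracM -!rmorphM E.
Qed.

Definition fraction_map : {fraction A} -> {fraction B} := sval (cid
  fraction_map_exists).

Lemma fraction_mapE n d : d != 0 -> fraction_map (n%:F / d%:F) = (f n)%:F / (f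
  d)%:F.
Proof. exact: (svalP (cid fraction_map_exists)). Qed.

Lemma fraction_map_tofrac a : fraction_map a%:F = (f a)%:F.
Proof.
by have := fraction_mapE a (oner_neq0 A); rewrite (rmorph1 f) !tofrac1 !divr1.
Qed.

Fact fraction_map_zmod : zmod_morphism fraction_map.
Proof.
move=> x y; have [n [d [d0 ->]]] := fractionP x.
have [m [e [e0 ->]]] := fractionP y; have fd := fn0 d0; have fe := fn0 e0.
rewrite -mulNr -tofracN addf_div ?tofrac_eq0 // -!tofracM -tofracD.
rewrite !fraction_mapE ?mulf_neq0 // (rmorphD f) !(rmorphM f) (rmorphN f).
by rewrite -mulNr -tofracN addf_div // -!tofracM -tofracD.
Qed.

Fact fraction_map_monoid : monoid_morphism fraction_map.
Proof.
split=> [|x y]; first by rewrite -tofrac1 fraction_map_tofrac (rmorph1 f)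
  tofrac1.
have [n [d [d0 ->]]] := fractionP x; have [m [e [e0 ->]]] := fractionP y.
rewrite mulf_div -!tofracM !fraction_mapE ?mulf_neq0 // !(rmorphM f).
by rewrite !tofracM -mulf_div.
Qed.

HB.instance Definition _ := GRing.isZmodMorphism.Build _ _ fraction_map
  fraction_map_zmod.
HB.instance Definition _ := GRing.isMonoidMorphism.Build _ _ fraction_map
  fraction_map_monoid.

End FractionMap.

Section PrimitiveElement.

Variables (K : numClosedFieldType) (n : nat) (F : n.-tuple (mpoly n K)).
Hypothesis F_inj : forall p : mpoly n K, p \mPo F = 0 -> p = 0.

Local Notation "x %:F" := (@FracField.tofrac _ x).
Local Notation phi := (comp_mpoly F).

(** [w] lies in the field generated by [z] over the field of fractions of the
    ring of polynomials in [F]. *)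
Definition generated z w :=
  exists2 D, D != 0 & exists Q, (D \mPo F) * w = ev F z Q.

Lemma generated_self z : generated z z.
Proof. by exists 1; rewrite ?oner_eq0 //; exists 'X;
  rewrite comp_mpoly1 mul1r evX. Qed.

Lemma generated_comp z c : generated z (c \mPo F).
Proof. by exists 1; rewrite ?oner_eq0 //; exists c%:P;
  rewrite comp_mpoly1 mul1r evC. Qed.

Lemma generatedD z u v : generated z u -> generated z v -> generated z (u + v).
Proof.
move=> [D D0 [Q DQ]] [E E0 [R ER]]; exists (D * E); first by rewrite mulf_neq0.
exists (E *: Q + D *: R); rewrite evD !evZ -DQ -ER (rmorphM phi) /=; ring.
Qed.

Lemma generatedM z u v : generated z u -> generated z v -> generated z (u * v).
Proof.
move=> [D D0 [Q DQ]] [E E0 [R ER]]; exists (D * E); first by rewrite mulf_neq0.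
exists (Q * R); rewrite evM -DQ -ER (rmorphM phi) /=; ring.
Qed.

Lemma generated_div z c w : c != 0 -> generated z ((c \mPo F) * w) -> generated
  z w.
Proof.
move=> c0 [D D0 [Q DQ]]; exists (D * c); first by rewrite mulf_neq0.
by exists Q; rewrite -DQ (rmorphM phi) mulrA.
Qed.

Lemma generated_ev z w Q : generated z w -> generated z (ev F w Q).
Proof.
move=> zw; elim/poly_ind: Q => [|Q c IH].
  by rewrite ev0 -(comp_mpoly0 F); apply: generated_comp.
rewrite evD evM evX evC; apply: generatedD; last exact: generated_comp.
exact: generatedM.
Qed.

Lemma generated_trans z w u : generated z w -> generated w u -> generated z u.
Proof.
move=> zw [D D0 [Q DQ]]; apply: (generated_div D0); rewrite DQ.
exact: generated_ev.
Qed.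

Lemma generated2 u v : exists z, generated z u /\ generated z v.
Proof.
pose iota : {rmorphism _ -> _} := fraction_map F_inj.
have iotaP Q : map_poly iota (map_poly (@FracField.tofrac _) Q) =
    map_poly (@FracField.tofrac _) (map_poly phi Q).
  by apply/polyP => i; rewrite !coef_map /= fraction_map_tofrac.
have evF w Q : (map_poly iota (map_poly (@FracField.tofrac _) Q)).[w%:F] = (ev
  F w Q)%:F.
  by rewrite iotaP horner_map.
have ann w : exists2 q, q != 0 & root (map_poly iota q) (w%:F).
  have [P P0 wP] := ev_dependent F w; exists (map_poly (@FracField.tofrac _) P).
    by rewrite map_poly_eq0_id0 // tofrac_eq0 lead_coef_eq0.
  by rewrite /root evF wP tofrac0.
have [p p0 pu] := ann u; have [q q0 qv] := ann v.
have char0 : [pchar {fraction (mpoly n K)}] =i pred0.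
  apply/pcharf0P => k; rewrite -tofrac1 -tofracMn tofrac_eq0.
  by rewrite -(rmorph_nat (@mpolyC n K)) mpolyC_eq0 pnatr_eq0.
have [k] := pchar0_PET p0 pu q0 qv char0.
rewrite -tofracMn -tofracB; set z := _ - _ => -[[a Da] [b Db]].
suff gen w r : (map_poly iota r).[z%:F] = w%:F -> generated z w.
  by exists z; split; [exact: gen Da|exact: gen Db].
move=> E; have [D D0 [Q DQ]] := fraction_clear_denominators r.
exists D => //; exists Q; apply/eqP; rewrite -tofrac_eq -evF -DQ map_polyZ /=.
by rewrite hornerZ E fraction_map_tofrac tofracM.
Qed.

(** The variables generate the ring of polynomials, so iterating the theorem
    of the primitive element makes one [z] generate everything. *)
Lemma primitive_element : exists z, forall w, generated z w.
Proof.
suff [z zX] : exists z, forall i : 'I_n, generated z 'X_i.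
  exists z; elim/mpoly_ring_ind => [c|//|p q|p q].
  - by rewrite -(comp_mpolyC c F); apply: generated_comp.
  - exact: generatedD.
  - exact: generatedM.
suff /(_ n) [z zX] : forall k, exists z, forall i : 'I_n, (i < k)%N ->
  generated z 'X_i.
  by exists z => i; apply: zX.
elim=> [|k [z zX]]; first by exists 0.
have [kn|nk] := ltnP k n; last first.
  by exists z => i _; apply: zX; apply: leq_trans nk.
have [z' [z'z z'k]] := generated2 z 'X_(Ordinal kn).
exists z' => i; rewrite ltnS leq_eqVlt => /orP[/eqP ik|ik].
  by rewrite (_ : i = Ordinal kn) //; apply: val_inj.
exact: generated_trans (zX i ik).
Qed.

End PrimitiveElement.

(** * Points of a generic fiber *)

Section Specialization.

Variables (K : numClosedFieldType) (n : nat).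

Definition pmap (F : n.-tuple (mpoly n K)) (x : 'I_n -> K) : 'I_n -> K :=
  fun i => (tnth F i).@[x].

Lemma meval_comp (F : n.-tuple (mpoly n K)) p x :
  (p \mPo F).@[x] = p.@[pmap F x].
Proof. exact: comp_mpoly_meval. Qed.

Definition specialize (y : 'I_n -> K) (t : K) (G : {poly mpoly n K}) : K :=
  (map_poly (meval y) G).[t].

HB.instance Definition _ y t := GRing.RMorphism.copy (specialize y t)
  (horner_eval t \o map_poly (meval y)).

Lemma specializeC y t c : specialize y t c%:P = c.@[y].
Proof. by rewrite /specialize map_polyC hornerC. Qed.

Lemma specializeX y t : specialize y t 'X = t.
Proof. by rewrite /specialize map_polyX hornerX. Qed.

Lemma specializeD y t : {morph specialize y t : G H / G + H}.
Proof. exact: (rmorphD (specialize y t)). Qed.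

Lemma specializeB y t : {morph specialize y t : G H / G - H}.
Proof. exact: (rmorphB (specialize y t)). Qed.

Lemma specializeM y t : {morph specialize y t : G H / G * H}.
Proof. exact: (rmorphM (specialize y t)). Qed.

Variable F : n.-tuple (mpoly n K).

Lemma meval_ev w G x : (ev F w G).@[x] = specialize (pmap F x) w.@[x] G.
Proof.
elim/poly_ind: G => [|G c IH].
  by rewrite ev0 meval0 (rmorph0 (specialize _ _)).
rewrite evD evM evX evC mevalD mevalM IH meval_comp.
by rewrite specializeD specializeM specializeX specializeC.
Qed.

Hypothesis F_inj : forall p : mpoly n K, p \mPo F = 0 -> p = 0.

Variables (z : mpoly n K) (P : {poly mpoly n K}).
Hypothesis mP : minimal_relation F z P.

(** Division by the minimal relation only introduces powers of its leading
    coefficient, so every relation of [z] survives where this does not vanish. *)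
Lemma specialize_relation y t H :
  (lead_coef P).@[y] != 0 -> specialize y t P = 0 -> ev F z H = 0 ->
  specialize y t H = 0.
Proof.
move=> ly Pyt zH; have [k [S E]] := minimal_relation_dvd mP zH.
have := congr1 (specialize y t) E.
rewrite -mul_polyC !specializeM specializeC Pyt mulr0 => /eqP.
by rewrite mulf_eq0 meval_exp expf_eq0 (negPf ly) andbF => /eqP.
Qed.

Variables (D : mpoly n K) (Q : 'I_n -> {poly mpoly n K}).
Hypothesis DQ : forall i, (D \mPo F) * 'X_i = ev F z (Q i).

(** The point is given by the expressions of the coordinates in terms of [z],
    evaluated at [z = t].  That it lies over [y] and that [z] takes the value [t]
    there are consequences of relations of [z]. *)
Lemma fiber_point y t :
  D.@[y] != 0 -> (lead_coef P).@[y] != 0 -> specialize y t P = 0 ->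
  let x i := specialize y t (Q i) / D.@[y] in
  pmap F x = y /\ z.@[x] = t.
Proof.
move=> Dy ly Pyt x.
(* Substituting [x] in [h] amounts to specializing an expression of [h] in
   terms of [z], with a power of [D] as denominator. *)
have subst (h : mpoly n K) : exists m G, ((D ^+ m) \mPo F) * h = ev F z G /\
    D.@[y] ^+ m * h.@[x] = specialize y t G.
  elim/mpoly_ring_ind: h => [c|i|p q [a [G [pG xG]]] [b [H [qH xH]]]|
                                 p q [a [G [pG xG]]] [b [H [qH xH]]]].
  - exists 0%N, (mpolyC n c)%:P; rewrite evC specializeC !expr0 comp_mpoly1.
    by rewrite comp_mpolyC !mevalC !mul1r.
  - exists 1%N, (Q i); rewrite !expr1 DQ mevalXU; split=> //.
    by rewrite mulrC divfK.
  - exists (a + b)%N, ((D ^+ b)%:P * G + (D ^+ a)%:P * H).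
    rewrite evD !evM !evC -pG -qH specializeD !specializeM !specializeC -xG -xH.
    rewrite !exprD (rmorphM (comp_mpoly F)) /= mevalD !meval_exp; split; ring.
  - exists (a + b)%N, (G * H); rewrite evM -pG -qH specializeM -xG -xH.
    rewrite !exprD (rmorphM (comp_mpoly F)) /= mevalM; split; ring.
have cancelD m (a b : K) : D.@[y] ^+ m * a = D.@[y] ^+ m * b -> a = b.
  by apply: mulfI; rewrite expf_neq0.
split.
  apply: funext => i; have [m [G [zG xG]]] := subst (tnth F i).
  apply: (cancelD m); rewrite xG; apply/eqP; rewrite -subr_eq0; apply/eqP.
  have <- : specialize y t (G - (D ^+ m * 'X_i)%:P) =
      specialize y t G - D.@[y] ^+ m * y i.
    by rewrite specializeB specializeC mevalM meval_exp mevalXU.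
  apply: specialize_relation => //.
  rewrite evB evC -zG (rmorphM (comp_mpoly F)) /= comp_mpolyXU -tnth_nth.
  by rewrite subrr.
have [m [G [zG xG]]] := subst z.
apply: (cancelD m); rewrite xG; apply/eqP; rewrite -subr_eq0; apply/eqP.
have <- : specialize y t (G - (D ^+ m)%:P * 'X) =
    specialize y t G - D.@[y] ^+ m * t.
  by rewrite specializeB specializeM specializeC specializeX meval_exp.
apply: specialize_relation => //.
by rewrite evB evM evC evX -zG subrr.
Qed.

Lemma fiber_coord x i : D.@[pmap F x] != 0 ->
  x i = specialize (pmap F x) z.@[x] (Q i) / D.@[pmap F x].
Proof.
move=> Dx; rewrite -meval_ev -DQ mevalM meval_comp mevalXU.
by rewrite mulrAC divff // mul1r.
Qed.

End Specialization.

Lemma generated_common_denominator (K : numClosedFieldType) (n : nat)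
    (F : n.-tuple (mpoly n K))
    (z : mpoly n K) (I : finType) (w : I -> mpoly n K) :
  (forall i, generated F z (w i)) ->
  exists2 D, D != 0 & exists Q : I -> {poly mpoly n K},
    forall i, (D \mPo F) * w i = ev F z (Q i).
Proof.
move=> gw; have /choice[DQ DQP] : forall i, exists DQ : mpoly n K * {poly mpoly
  n K},
    DQ.1 != 0 /\ (DQ.1 \mPo F) * w i = ev F z DQ.2.
  by move=> i; have [D D0 [Q E]] := gw i; exists (D, Q).
exists (\prod_i (DQ i).1).
  by apply/prodf_neq0 => i _; have [] := DQP i.
exists (fun i => (\prod_(j | j != i) (DQ j).1)%:P * (DQ i).2) => i.
have [_ E] := DQP i; rewrite evM evC -E (bigD1 i) //= (rmorphM (comp_mpoly F)).
by rewrite [in RHS]mulrCA mulrA.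
Qed.

(** * Mappings with two points in the regular fibers *)

Section DegreeTwo.

Variables (K : numClosedFieldType) (n : nat) (F : n.-tuple (mpoly n K)).

Hypothesis F_deg2 : forall y,
  (forall x, pmap F x = y -> (\det (jacobian F)).@[x] != 0) ->
  exists u v, [/\ pmap F u = y, pmap F v = y, u <> v &
    forall x, pmap F x = y -> x = u \/ x = v].

(** A value outside the image would be regular, so its fiber would
    have two points. *)
Lemma pmap_surj y : exists x, pmap F x = y.
Proof.
have [reg|] := pselect (forall x, pmap F x = y -> (\det (jacobian F)).@[x] !=
  0).
  by have [u [_ [Fu _ _ _]]] := F_deg2 reg; exists u.
by move=> /existsNP[x /not_implyP[Fx _]]; exists x.
Qed.

Lemma comp_mpoly_inj (p : mpoly n K) : p \mPo F = 0 -> p = 0.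
Proof.
move=> p0; apply/eqP; apply: contraT => /mpoly_nonroot[y].
by have [x <-] := pmap_surj y; rewrite -meval_comp p0 meval0 eqxx.
Qed.

(** Over a generic [y], the specialized minimal relation has simple roots, since
    its derivative divides a polynomial in [F] that does not vanish at [y]; and
    its roots correspond to the two points of the fiber. *)
Lemma size_minimal_relation z P :
  (forall w, generated F z w) -> minimal_relation F z P -> size P = 3%N.
Proof.
move=> gz mP; have [P0 zP _] := mP.
have [D D0 [Q DQ]] := generated_common_denominator (fun i : 'I_n => gz 'X_i).
have [E E0 [v Ev]] := dvd_comp F (minimal_relation_separable comp_mpoly_inj mP).
have [J J0 [v' Jv]] := dvd_comp F (det_jacobian_neq0 comp_mpoly_inj).
have : D * lead_coef P * E * J != 0 by rewrite !mulf_neq0 // lead_coef_eq0.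
case/mpoly_nonroot => y; rewrite !mevalM !mulf_eq0 !negb_or.
case/andP=> /andP[/andP[Dy ly] Ey] Jy.
have [|a [b [Fa Fb ab fib]]] := F_deg2 (y := y).
  move=> x Fx; have : (J \mPo F).@[x] != 0 by rewrite meval_comp Fx.
  by rewrite Jv mevalM mulf_eq0 negb_or => /andP[].
pose py := map_poly (meval y) P.
have spy : size py = size P by rewrite size_map_poly_id0.
have py0 : py != 0 by rewrite -size_poly_eq0 spy size_poly_eq0.
have rpy t : root py t -> t = z.@[a] \/ t = z.@[b].
  move=> /rootP ty; have [Fx <-] := fiber_point mP DQ Dy ly ty.
  by have [->|->] := fib _ Fx; [left|right].
have apy x : pmap F x = y -> root py z.@[x].
  move=> Fx; apply/rootP; have := meval_ev F z P x.
  by rewrite zP meval0 Fx => /esym.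
have zab : z.@[a] != z.@[b].
  apply/eqP => zab; apply: ab; apply: funext => i.
  have Da : D.@[pmap F a] != 0 by rewrite Fa.
  have Db : D.@[pmap F b] != 0 by rewrite Fb.
  by rewrite (fiber_coord DQ i Da) (fiber_coord DQ i Db) Fa Fb zab.
have sep : separable_poly py.
  rewrite unlock; apply: contraT => /closed_rootP[t].
  rewrite root_gcd => /andP[/rootP pt /rootP].
  rewrite deriv_map => dt; have [Fx zx] := fiber_point mP DQ Dy ly pt.
  set x := (fun i => _) in Fx zx.
  have : (E \mPo F).@[x] != 0 by rewrite meval_comp Fx.
  by rewrite Ev mevalM meval_ev Fx zx /specialize dt mul0r eqxx.
have [rs Drs] := closed_field_poly_normal py.
have lpy0 : lead_coef py != 0 by rewrite lead_coef_eq0.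
have urs : uniq rs.
  by rewrite -separable_prod_XsubC; move: sep;
    rewrite {1}Drs (eqp_separable (eqp_scale _ lpy0)).
have mrs t : (t \in rs) = root py t.
  by rewrite Drs rootZ // root_prod_XsubC.
rewrite -spy Drs size_scale // size_prod_XsubC; congr _.+1.
apply/eqP; rewrite eqn_leq; apply/andP; split.
  have -> : 2%N = size [:: z.@[a]; z.@[b]] by [].
  apply: uniq_leq_size => // t; rewrite mrs => /rpy[->|->];
    rewrite !inE eqxx ?orbT //.
have -> : 2%N = size [:: z.@[a]; z.@[b]] by [].
apply: uniq_leq_size => [|t]; first by rewrite /= inE zab.
by rewrite !inE mrs => /orP[/eqP->|/eqP->]; apply: apy.
Qed.

(** A generator of the function field over the field of fractions of C[F], whose
    conjugate is [- z]. *)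
Definition quadratic_generator z delta :=
  [/\ z ^+ 2 = delta \mPo F,
      forall A B, (A \mPo F) * z + (B \mPo F) = 0 -> A = 0 /\ B = 0 &
      forall w, generated F z w].

Lemma poly_size2 (R : nzRingType) (H : {poly R}) :
  (size H <= 2)%N -> H = H`_1 *: 'X + (H`_0)%:P.
Proof.
move=> sH; apply/polyP => -[|[|i]]; rewrite coefD coefZ coefX coefC /=.
- by rewrite mulr0 add0r.
- by rewrite mulr1 addr0.
- by rewrite mulr0 addr0 nth_default // (leq_trans sH).
Qed.

Lemma coef1_linear (R : nzRingType) (a b : R) : (a%:P * 'X + b%:P)`_1 = a.
Proof. by rewrite coefD coefCM coefX coefC mulr1 addr0. Qed.

(** Complete the square in the minimal relation of a primitive element. *)
Lemma quadratic_generator_exists : exists z delta, quadratic_generator z delta.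
Proof.
have [z gz] := primitive_element comp_mpoly_inj.
have [P mP] := minimal_relation_exists F z.
have sP := size_minimal_relation gz mP; have [P0 zP minP] := mP.
pose a := P`_2; pose b := P`_1; pose c := P`_0.
have DP : P = a%:P * 'X ^+ 2 + b%:P * 'X + c%:P.
  apply/polyP => -[|[|[|i]]];
    rewrite !coefD !coefCM coefXn coefX coefC /= ?(mulr0, mulr1, add0r, addr0)
    //.
  by rewrite nth_default // sP.
have a0 : a != 0 by rewrite /a -[2%N]/(3.-1)%N -sP -lead_coefE lead_coef_eq0.
have two0 : 2%:R * a != 0.
  rewrite mulf_neq0 // -(rmorph_nat (@mpolyC n K)) mpolyC_eq0 pnatr_eq0 //.
have quad : (a \mPo F) * z ^+ 2 + (b \mPo F) * z + (c \mPo F) = 0.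
  by rewrite -zP {1}DP !evD !evM !evC !evX expr2.
pose y := ((2%:R * a) \mPo F) * z + (b \mPo F).
exists y, (b ^+ 2 - 4%:R * a * c).
have phi2 : 2%:R \mPo F = 2%:R by rewrite (rmorph_nat (comp_mpoly F)).
have phi4 : 4%:R \mPo F = 4%:R by rewrite (rmorph_nat (comp_mpoly F)).
split.
- rewrite /y comp_mpolyB !(rmorphM (comp_mpoly F)) /=.
  rewrite phi2 phi4; move: quad; set A := a \mPo F; set B := b \mPo F;
    set C := c \mPo F.
  move=> quad; apply/eqP; rewrite -subr_eq0; apply/eqP.
  transitivity (4%:R * A * (A * z ^+ 2 + B * z + C)); first by ring.
  by rewrite quad mulr0.
- move=> A B AB; pose G := (A * (2%:R * a))%:P * 'X + (A * b + B)%:P.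
  have /minP : ev F z G = 0.
    rewrite evD evM !evC evX -[RHS]AB /y comp_mpolyD !(rmorphM (comp_mpoly F))
      /=; ring.
  have sG : (size G < size P)%N.
    rewrite sP ltnS (leq_trans (size_polyD _ _)) // geq_max mul_polyC.
    rewrite (leq_trans (size_scale_leq _ _)) ?size_polyX //.
    by rewrite (leq_trans (size_polyC_leq1 _)).
  move=> /(_ sG) G0; have /eqP : A * (2%:R * a) = 0.
    have := congr1 (fun p : {poly mpoly n K} => p`_1) G0.
    by move=> /(etrans (esym (coef1_linear _ _))) ->; rewrite coef0.
  rewrite mulf_eq0 (negPf two0) orbF => /eqP A0; split=> //.
  by apply: comp_mpoly_inj; move: AB; rewrite A0 comp_mpoly0 mul0r add0r.
- move=> w; apply: generated_trans (gz w); apply: (generated_div two0).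
  have -> : ((2%:R * a) \mPo F) * z = y + ((- b) \mPo F).
    by rewrite /y comp_mpolyN addrK.
  by apply: generatedD; [exact: generated_self|exact: generated_comp].
Qed.

Lemma quadratic_generator_minimal z delta :
  quadratic_generator z delta -> minimal_relation F z ('X^2 - delta%:P).
Proof.
move=> [zz free _].
have sz : size ('X^2 - delta%:P) = 3%N.
  rewrite size_polyDl size_polyXn // size_polyN.
  by rewrite (leq_ltn_trans (size_polyC_leq1 _)).
split.
- by rewrite -size_poly_eq0 sz.
- by rewrite evB evC (rmorphXn (ev F z)) /= evX zz subrr.
move=> H zH; rewrite sz ltnS => /poly_size2 DH.
have [H1 H0] : H`_1 = 0 /\ H`_0 = 0.
  by move: zH; rewrite {1}DH evD evZ evX evC => /free.
by rewrite DH H1 H0 scale0r add0r.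
Qed.

Lemma ev_cons w Q c : ev F w (Q * 'X + c%:P) = ev F w Q * w + (c \mPo F).
Proof. by rewrite evD evM evC evX. Qed.

Lemma ev_linear w A B :
  ev F w (A%:P * 'X + B%:P) = (A \mPo F) * w + (B \mPo F).
Proof. by rewrite ev_cons evC. Qed.

Lemma quadratic_generator_linear z delta Q :
  quadratic_generator z delta ->
  exists A B, ev F z Q = ev F z (A%:P * 'X + B%:P).
Proof.
move=> [zz _ _]; elim/poly_ind: Q => [|Q c [A [B IH]]].
  by exists 0, 0; rewrite !polyC0 mul0r addr0.
exists B, (A * delta + c).
apply: (etrans (ev_cons _ _ _)); apply: (etrans _ (esym (ev_linear _ _ _))).
rewrite IH; apply: (etrans (congr1 (fun p => p * z + _) (ev_linear _ _ _))).
rewrite comp_mpolyD (rmorphM (comp_mpoly F)) /= -zz; ring.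
Qed.

Lemma quadratic_generator_neq0 z delta : quadratic_generator z delta -> z != 0.
Proof.
move=> [_ free _]; apply/eqP => z0.
have [] := free 1 0; first by rewrite z0 mulr0 comp_mpoly0 addr0.
by move/eqP; rewrite oner_eq0.
Qed.

End DegreeTwo.

(** * The involution of the fibers *)

Section DeckInvolution.

Variables (K : numClosedFieldType) (n : nat) (F : n.-tuple (mpoly n K)).

Hypothesis F_deg2 : forall y,
  (forall x, pmap F x = y -> (\det (jacobian F)).@[x] != 0) ->
  exists u v, [/\ pmap F u = y, pmap F v = y, u <> v &
    forall x, pmap F x = y -> x = u \/ x = v].

Hypothesis F_proper : forall y v : 'I_n -> K,
  exists2 M : K, 0 <= M & forall s : K, 0 < s -> s <= 1 ->
  forall x, pmap F x = (fun i => y i + s * v i) -> forall i, `|x i| <= M.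

Hypothesis F_proper' : forall y v : 'I_n -> K,
  exists2 M : K, 0 <= M & forall s : K, 0 < s -> s <= 1 ->
  forall x, pmap F x = pmap F (fun i => y i + s * v i) -> forall i, `|x i| <= M.

Let F_inj := comp_mpoly_inj F_deg2.

Lemma mpoly_eq_off (q p r : mpoly n K) :
  q != 0 -> (forall x, q.@[x] != 0 -> p.@[x] = r.@[x]) -> p = r.
Proof.
move=> q0 H; apply/eqP; rewrite -subr_eq0; apply: contraT => pr.
have : q * (p - r) != 0 by rewrite mulf_neq0.
case/mpoly_nonroot => x; rewrite mevalM mulf_eq0 negb_or => /andP[qx].
by rewrite mevalB subr_eq0 H // eqxx.
Qed.

Variables (z delta : mpoly n K).
Hypothesis zP : quadratic_generator F z delta.

Lemma quadratic_decomposition w : exists2 D, D != 0 & exists A B,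
  (D \mPo F) * w = (A \mPo F) * z + (B \mPo F).
Proof.
have [_ _ /(_ w) [D D0 [Q DQ]]] := zP;
  have [A [B E]] := quadratic_generator_linear Q zP.
by exists D => //; exists A, B; rewrite DQ E ev_linear.
Qed.

(** Where the common denominator [q] does not vanish, the point of the fiber at
    which [z] takes the opposite value has coordinates [p i / q].  They are
    bounded on segments, since they stay in a fiber over the image of the
    segment; so [q] divides [p i]. *)
Lemma deck_involution_exists : exists Phi : n.-tuple (mpoly n K),
  [/\ forall x, pmap F (pmap Phi x) = pmap F x,
      forall x, z.@[pmap Phi x] = - z.@[x] &
      forall x, pmap Phi (pmap Phi x) = x].
Proof.
have [D D0 [A [B DAB]]] : exists2 D, D != 0 & exists A B : 'I_n -> mpoly n K,
    forall i, (D \mPo F) * 'X_i = (A i \mPo F) * z + (B i \mPo F).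
  have [_ _ gz] := zP.
  have [D D0 [Q DQ]] := generated_common_denominator (fun i : 'I_n => gz 'X_i).
  exists D => //.
  have /choice[A AP] : forall i, exists AB : mpoly n K * mpoly n K,
      ev F z (Q i) = ev F z (AB.1%:P * 'X + AB.2%:P).
    by move=> i; have [A [B E]] := quadratic_generator_linear (Q i) zP;
      exists (A, B).
  exists (fun i => (A i).1), (fun i => (A i).2) => i.
  by rewrite DQ AP ev_linear.
pose Q i := (A i)%:P * 'X + (B i)%:P.
have DQ i : (D \mPo F) * 'X_i = ev F z (Q i) by rewrite ev_linear.
pose q := D \mPo F; have q0 : q != 0 by apply: comp_neq0.
(* The coordinates, as functions of [z], evaluated at the conjugate of [z]. *)
pose sigma x i := specialize (pmap F x) (- z.@[x]) (Q i) / q.@[x].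
have qF x : q.@[x] = D.@[pmap F x] by rewrite meval_comp.
have sigmaP x : q.@[x] != 0 ->
    pmap F (sigma x) = pmap F x /\ z.@[sigma x] = - z.@[x].
  move=> qx; rewrite /sigma qF.
  have [zz _ _] := zP.
  apply: (fiber_point (quadratic_generator_minimal zP) DQ).
  - by rewrite -qF.
  - rewrite lead_coefDl ?lead_coefXn ?meval1 ?oner_eq0 //.
    by rewrite size_polyN size_polyXn (leq_ltn_trans (size_polyC_leq1 _)).
  rewrite specializeB (rmorphXn (specialize _ _)) /= specializeX specializeC.
  by rewrite sqrrN -meval_comp -zz meval_exp subrr.
pose p i := (B i \mPo F) - (A i \mPo F) * z.
have pE x i : q.@[x] != 0 -> (p i).@[x] = sigma x i * q.@[x].
  move=> qx; rewrite /sigma divfK // specializeD specializeM !specializeC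
    specializeX.
  by rewrite /p mevalB mevalM !meval_comp mulrN addrC.
have /choice[Phi PhiE] : forall i, exists c, p i = c * q.
  move=> i; apply: mpoly_dvd_of_bounded => // y v.
  have [M M0 HM] := F_proper' y v; exists M => // s s0 s1 qx.
  rewrite pE // normrM ler_wpM2r //; apply: (HM _ s0 s1).
  by have [] := sigmaP _ qx.
have PhiS x : q.@[x] != 0 -> pmap [tuple Phi i | i < n] x = sigma x.
  move=> qx; apply: funext => i; rewrite /pmap tnth_mktuple.
  by apply: (mulIf qx); rewrite -mevalM -PhiE pE.
exists [tuple Phi i | i < n]; set T := [tuple _ | _ < _].
have FT j : (tnth F j) \mPo T = tnth F j.
  apply: (mpoly_eq_off q0) => x qx; rewrite meval_comp PhiS //.
  by have [/(congr1 (fun f => f j))] := sigmaP x qx.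
have zT : z \mPo T = - z.
  apply: (mpoly_eq_off q0) => x qx; rewrite meval_comp PhiS // mevalN.
  by have [] := sigmaP x qx.
have TT i : (tnth T i) \mPo T = 'X_i.
  apply: (mpoly_eq_off q0) => x qx; rewrite meval_comp PhiS // mevalXU.
  have [Fx zx] := sigmaP x qx.
  have qs : q.@[sigma x] != 0 by rewrite qF Fx -qF.
  rewrite -[LHS]/(pmap T (sigma x) i) PhiS //.
  rewrite {1}/sigma zx opprK qF Fx -fiber_coord //; last by rewrite -qF.
split=> x.
- by apply: funext => j; rewrite {1}/pmap -meval_comp FT.
- by rewrite -meval_comp zT mevalN.
- by apply: funext => j; rewrite {1}/pmap -meval_comp TT mevalXU.
Qed.

(** Decompose [h] as a combination of 1 and [z] over the fractions of C[F]: the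
    coefficient of [z] changes sign under [Phi], so it vanishes, and [h] is a
    quotient of polynomials in [F].  It is bounded over segments of the target,
    so the denominator divides. *)
Lemma deck_invariant (Phi : n.-tuple (mpoly n K)) h :
  (forall x, pmap F (pmap Phi x) = pmap F x) ->
  (forall x, z.@[pmap Phi x] = - z.@[x]) ->
  (forall x, h.@[pmap Phi x] = h.@[x]) -> exists g, h = g \mPo F.
Proof.
move=> FPhi zPhi hPhi.
have [D D0 [A [B DAB]]] := quadratic_decomposition h.
have DABx x : D.@[pmap F x] * h.@[x] = A.@[pmap F x] * z.@[x] + B.@[pmap F x].
  by rewrite -!meval_comp -!mevalM DAB mevalD mevalM.
have A0 : A = 0.
  have : (A \mPo F) * z = 0.
    apply: (mpoly_eq_off (oner_neq0 _)) => x _;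
      rewrite meval0 mevalM meval_comp.
    have := DABx (pmap Phi x); rewrite FPhi hPhi zPhi DABx mulrN => /addIr/eqP.
    by rewrite -addr_eq0 -mulr2n mulrn_eq0 /= => /eqP.
  move=> /eqP; rewrite mulf_eq0 (negPf (quadratic_generator_neq0 zP)) orbF =>
    /eqP.
  exact: F_inj.
have DB x : D.@[pmap F x] * h.@[x] = B.@[pmap F x].
  by rewrite DABx A0 meval0 mul0r add0r.
have [g Bg] : exists g, B = g * D.
  apply: mpoly_dvd_of_bounded => // y v.
  have [M M0 HM] := F_proper y v; have [N HN] := meval_bound h M.
  exists `|N| => // s s0 s1 _.
  have [x Fx] := pmap_surj F_deg2 (fun i => y i + s * v i).
  rewrite -Fx -DB normrM mulrC ler_wpM2r //.
  have hN := HN _ (HM s s0 s1 x Fx); rewrite (le_trans hN) // real_ler_norm //.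
  by rewrite ger0_real // (le_trans _ hN).
exists g; apply: (mpoly_eq_off (comp_neq0 F_inj D0)) => x;
  rewrite !meval_comp => Dx.
by apply: (mulfI Dx); rewrite DB Bg mevalM mulrC.
Qed.

End DeckInvolution.

(** * Diagonal involutions with a polynomial ring of invariants *)

Section Reflection.

Variables (K : numClosedFieldType) (n : nat) (G : n.-tuple (mpoly n K)).
Variable e : 'I_n -> K.

Definition sign_invariant (h : mpoly n K) :=
  forall x : 'I_n -> K, h.@[fun i => e i * x i] = h.@[x].

Hypothesis e2 : forall i, e i = 1 \/ e i = -1.
Hypothesis G_inv : forall j, sign_invariant (tnth G j).
Hypothesis G_gen : forall h, sign_invariant h -> exists g, h = g \mPo G.

Let at0 (h : mpoly n K) : K := h.@[fun=> 0].

Lemma sign_invariant_deriv0 h i :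
  sign_invariant h -> e i = -1 -> at0 (mderiv i h) = 0.
Proof.
move=> inv ei; pose E := [tuple e i *: ('X_i : mpoly n K) | i < n].
have hE : h \mPo E = h.
  apply: (mpoly_eq_off (oner_neq0 _)) => x _; rewrite meval_comp -[RHS]inv.
  by apply: meval_eq => j; rewrite /pmap tnth_mktuple mevalZ mevalXU.
have /(congr1 (mderiv i)) := hE; rewrite comp_mpoly_deriv.
rewrite (bigD1 i) //= big1 => [|j ji]; rewrite tnth_mktuple mderivZ mderivXU.
  rewrite eqxx addr0 ei mpolyC1 => /(congr1 at0).
  rewrite /at0 mevalM mevalZ meval1 mulr1 meval_comp mulrN1.
  rewrite (@meval_eq _ _ _ (fun=> 0)) => [/esym/eqP|j]; last first.
    by rewrite /pmap tnth_mktuple mevalZ mevalXU mulr0.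
  by rewrite -addr_eq0 -mulr2n mulrn_eq0 /= => /eqP.
by rewrite (negPf ji) mpolyC0 scaler0 mulr0.
Qed.

(** A point derivation at the origin on the ring of invariants is determined by
    its values on the [n] generators [G], so there are at most [n] independent
    ones.  Two minus signs, at [a] and [b], would give [n + 1]: the invariants
    [x_a x_b], and [x_i ^ 2] or [x_i] according to the sign at [i], pick out
    coefficients that are point derivations, because the invariants have no
    linear terms in the variables with a minus sign. *)
Lemma unique_sign a b : e a = -1 -> e b = -1 -> a = b.
Proof.
move=> ea eb; apply/eqP; apply: contraT => ab.
pose lam (k : option 'I_n) (h : mpoly n K) : K := at0
  match k with
  | None => mderiv a (mderiv b h)
  | Some i => if e i == -1 then mderiv i (mderiv i h) else mderiv i h
  end.
pose t (k : option 'I_n) : mpoly n K :=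
  match k with
  | None => 'X_a * 'X_b
  | Some i => if e i == -1 then 'X_i * 'X_i else 'X_i
  end.
(* [c] combines the [n + 1] derivations into [mu], which kills the [n]
   generators. *)
have [|c [k ck] cG] := linear_dependence (fun k j => lam k (tnth G j)).
  by rewrite card_option card_ord.
have at0D : {morph at0 : p q / p + q} by move=> p q; rewrite /at0 mevalD.
have at0M : {morph at0 : p q / p * q} by move=> p q; rewrite /at0 mevalM.
have lamD l : {morph lam l : p q / p + q}.
  by move=> p q; rewrite /lam; case: l => [i|]; first case: ifP => _;
    rewrite !mderivD at0D.
have lamC l d : lam l (mpolyC n d) = 0.
  by rewrite /lam /at0; case: l => [i|]; first case: ifP => _;
    rewrite !(mderivC, mderiv0) meval0.
have lamM l p q : sign_invariant p -> sign_invariant q ->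
    lam l (p * q) = at0 p * lam l q + at0 q * lam l p.
  move=> ip iq; have dp i := @sign_invariant_deriv0 p i ip.
  have dq i := @sign_invariant_deriv0 q i iq.
  rewrite /lam; case: l => [i|]; first case: eqP => [ei|_].
  - rewrite !(mderivM, mderivD) !(at0D, at0M) dp // dq //; ring.
  - rewrite !(mderivM, mderivD) !(at0D, at0M); ring.
  - rewrite !(mderivM, mderivD) !(at0D, at0M) !dp // !dq //; ring.
pose mu h := \sum_l c l * lam l h.
have muG g : mu (g \mPo G) = 0.
  have inv p : sign_invariant (p \mPo G).
    by move=> x; rewrite !meval_comp; apply: meval_eq => j; apply: G_inv.
  elim/mpoly_ring_ind: g => [d|j|p q IHp IHq|p q IHp IHq].
  - by rewrite comp_mpolyC /mu big1 // => l _; rewrite lamC mulr0.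
  - by rewrite comp_mpolyXU -tnth_nth; apply: cG.
  - rewrite comp_mpolyD -[RHS]addr0 -{1}IHp -IHq /mu -big_split /=.
    by apply: eq_bigr => l _; rewrite lamD mulrDr.
  - rewrite (rmorphM (comp_mpoly G)) /=; move: (inv p) (inv q) IHp IHq.
    move: (p \mPo G) (q \mPo G) => u v iu iv muu muv.
    transitivity (at0 u * mu v + at0 v * mu u);
      last by rewrite muu muv !mulr0 addr0.
    rewrite /mu [at0 u * _]mulr_sumr [at0 v * _]mulr_sumr -big_split /=.
    apply: eq_bigr => l _; rewrite (lamM l u v iu iv) mulrDr.
    by rewrite !mulrA ![c l * _]mulrC.
have muT l : mu (t l) = 0.
  suff /G_gen[g ->] : sign_invariant (t l) by apply: muG.
  move=> x; rewrite /t; case: l => [i|]; last first.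
    rewrite !mevalM !mevalXU ea eb; ring.
  case: eqP => [ei|ni]; rewrite ?mevalM !mevalXU; first by rewrite ei; ring.
  by have [->|//] := e2 i; rewrite mul1r.
have d0 i : at0 'X_i = 0 by rewrite /at0 mevalXU.
have d1 i j : at0 (mderiv i 'X_j) = (j == i)%:R by rewrite mderivXU /at0 mevalC.
have d2 i j l : mderiv i (mderiv j ('X_l : mpoly n K)) = 0 by rewrite mderivXU
  mderivC.
have dd i j l m : at0 (mderiv i (mderiv j ('X_l * 'X_m : mpoly n K))) =
    (l == j)%:R * (m == i)%:R + (l == i)%:R * (m == j)%:R.
  rewrite !(mderivM, mderivD) !(at0D, at0M) !d0 !d1; ring.
have dm i l m : at0 (mderiv i ('X_l * 'X_m : mpoly n K)) = 0.
  rewrite !(mderivM, mderivD) !(at0D, at0M) !d0 !d1; ring.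
have at00 : at0 0 = 0 by rewrite /at0 meval0.
have lamt l m : l != m -> lam l (t m) = 0.
  rewrite /lam /t; case: l m => [i|] [j|] //=; rewrite ?(inj_eq Some_inj) => lm.
  - case: eqP => ei; case: eqP => ej;
    rewrite ?dd ?dm ?d2 ?d1 // eq_sym (negPf lm) ?mulr0 ?mul0r ?addr0 //.
  - case: eqP => ei; rewrite ?dd ?dm //.
    have [ia|_] := eqVneq a i; last by rewrite !mul0r addr0.
    by rewrite -ia eq_sym (negPf ab) !mulr0 addr0.
  - case: eqP => ej; rewrite ?dd ?d2 //.
    have [ja|_] := eqVneq j a; last by rewrite mulr0 mul0r addr0.
    by rewrite ja (negPf ab) mulr0 mul0r addr0.
have lamt0 l : lam l (t l) != 0.
  rewrite /lam /t; case: l => [i|] /=.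
    by case: (e i == -1);
      rewrite ?dd ?d1 eqxx ?mulr1 ?pnatr_eq0 // -mulr2n pnatr_eq0.
  by rewrite dd eqxx (negPf ab) mul0r add0r eqxx mulr1 oner_eq0.
have := muT k; rewrite /mu (bigD1 k) //= big1 => [|l lk]; last first.
  by rewrite lamt ?mulr0 // eq_sym.
by move/eqP; rewrite addr0 mulf_eq0 (negPf ck) (negPf (lamt0 k)).
Qed.

End Reflection.

(** * Bounds from properness *)

Section Properness.

Variable R : realType.

Lemma C_ge0E (z : C R) : 0 <= z -> exists2 r : R, 0 <= r & z = r%:C%C.
Proof.
case: z => a b; rewrite lecE /= => /andP[/eqP -> a0]; by exists a.
Qed.

Lemma C_lt0E (r : R) : (0 < r%:C%C :> C R) = (0 < r).
Proof. exact: (ltcR 0 r). Qed.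

Lemma C_le0E (r : R) : (0 <= r%:C%C :> C R) = (0 <= r).
Proof. exact: (lecR 0 r). Qed.

Lemma compact_C_bounded (A : set (C R)) :
  compact A -> exists2 M, 0 <= M & forall x, A x -> `|x| <= M.
Proof.
rewrite compact_cover => /(_ nat setT (fun k =>
  [set x | `|x| < k%:R])%classic) [].
- move=> k _; rewrite openE => p; rewrite /= -subr_gt0 => lt.
  apply/nbhs_ballP; exists (k%:R - `|p|) => // q.
  rewrite -ball_normE /= ltrBrDr distrC; apply: le_lt_trans.
  by rewrite -{1}(subrK p q) ler_normD.
- move=> p _; have [r r0 Er] := C_ge0E (normr_ge0 p).
  exists (Num.truncn r).+1 => //=;
    rewrite Er -[X in _ < X](rmorph_nat (@real_complex R)).
  by rewrite ltcR truncnS_gt.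
move=> D _ DA; exists (\max_(k <- finmap.enum_fset D) k)%:R; first exact: ler0n.
move=> x /DA[k Dk /ltW]; move/le_trans; apply.
by rewrite ler_nat; apply: leq_bigmax_seq.
Qed.

Lemma compact_rV_bounded n (A : set 'rV[C R]_n) :
  compact A -> exists2 M, 0 <= M & forall x, A x -> forall i, `|x 0 i| <= M.
Proof.
move=> cA; have /choice[M HM] :
    forall i, exists M, 0 <= M /\ forall x, A x -> `|x 0 i| <= M.
  move=> i; have [|M M0 HM] := @compact_C_bounded ((fun x : 'rV[C R]_n =>
    x 0 i) @` A)%classic.
    apply: continuous_compact => //; apply: continuous_subspaceT.
    exact: coord_continuous.
  by exists M; split=> // x Ax; apply: HM; exists x.
exists (\sum_i M i); first by apply: sumr_ge0 => i _; have [] := HM i.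
move=> x Ax i; have [_ /(_ x Ax) h] := HM i; apply: (le_trans h).
rewrite (bigD1 i) //= lerDl; apply: sumr_ge0 => j _; by have [] := HM j.
Qed.

Definition line n (y v : 'I_n -> C R) (s : C R) : 'rV[C R]_n :=
  \row_i (y i + s * v i).

Lemma compact_segment n (y v : 'I_n -> C R) :
  compact ((fun s : R => line y v s%:C%C) @` `[0, 1])%classic.
Proof.
apply: continuous_compact; last exact: segment_compact.
apply: continuous_subspaceT => s W /= /(nbhs_ballP (line y v s%:C%C))[e e0 eW].
have [e' e'0 Ee] := C_ge0E (ltW e0).
have [V V0 EV] : exists2 V : R, 0 <= V & \sum_i `|v i| = V%:C%C.
  by apply: C_ge0E; apply: sumr_ge0.
have d0 : 0 < e' / (V + 1).
  rewrite divr_gt0 ?ltr_wpDl //; by rewrite -C_lt0E -Ee.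
apply/nbhs_ballP; exists (e' / (V + 1)) => // t.
rewrite -ball_normE /= ltr_pdivlMr ?ltr_wpDl // => lt; apply: eW.
split=> // a i; rewrite -ball_normE /= !mxE.
have -> : y i + s%:C%C * v i - (y i + t%:C%C * v i) = (s - t)%:C%C * v i.
  by rewrite (rmorphB (@real_complex R)) /=; ring.
have vV : `|v i| <= V%:C%C.
  by rewrite -EV (bigD1 i) //= lerDl; apply: sumr_ge0.
have nst : `|(s - t)%:C%C| = `|s - t|%:C%C :> C R.
  by rewrite normc_def /= expr0n addr0 sqrtr_sqr.
rewrite normrM nst Ee; apply: (@le_lt_trans _ _ (`|s - t| * V)%:C%C).
  by rewrite (rmorphM (@real_complex R)) ler_wpM2l // C_le0E.
have {}lt : `|s - t| * V < e'.
  by apply: le_lt_trans lt; rewrite mulrDr lerDl mulr1.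
by rewrite -(ltcR (`|s - t| * V) e') in lt.
Qed.

Variables (n : nat) (f : polynomial_mapping R n).

Lemma polymapE (x : 'rV[C R]_n) : polymap f x = \row_i pmap f (x 0) i.
Proof. by apply/rowP => i; rewrite !mxE. Qed.

Lemma row_coord (x : 'I_n -> C R) : (\row_i x i) 0 = x.
Proof. by apply: funext => i; rewrite mxE. Qed.

Hypothesis f_proper : proper_mapping (polymap f).

Lemma segmentP (y v : 'I_n -> C R) s : 0 < s -> s <= 1 ->
  ((fun s : R => line y v s%:C%C) @` `[0, 1])%classic (line y v s).
Proof.
move=> s0 s1; have [r r0 Er] := C_ge0E (ltW s0); exists r; last by rewrite Er.
by rewrite /= in_itv /= r0 -(lecR r 1) -Er.
Qed.

Lemma proper_segment_bounded (y v : 'I_n -> C R) :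
  exists2 M, 0 <= M & forall s, 0 < s -> s <= 1 ->
  forall x, pmap f x = (fun i => y i + s * v i) -> forall i, `|x i| <= M.
Proof.
have [_ prop] := f_proper; have := prop _ (@compact_segment n y v).
case/compact_rV_bounded => M M0 HM; exists M => // s s0 s1 x fx i.
have := HM (\row_i x i) _ i; rewrite mxE; apply.
rewrite /= polymapE row_coord fx; exact: segmentP.
Qed.

Lemma proper_image_segment_bounded (y v : 'I_n -> C R) :
  exists2 M, 0 <= M & forall s, 0 < s -> s <= 1 ->
  forall x, pmap f x = pmap f (fun i => y i + s * v i) -> forall i, `|x i| <= M.
Proof.
have [cont prop] := f_proper.
have /prop := continuous_compact (continuous_subspaceT cont) (@compact_segment
  n y v).
case/compact_rV_bounded => M M0 HM; exists M => // s s0 s1 x fx i.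
have := HM (\row_i x i) _ i; rewrite mxE; apply.
exists (line y v s); first exact: segmentP.
by rewrite !polymapE !row_coord fx.
Qed.

End Properness.

(** * Invariants of a reflection *)

Section SquareFirst.

Variables (K : numClosedFieldType) (n : nat).

Let S : n.+1.-tuple (mpoly n.+1 K) :=
  [tuple let X := mpolyX K (mnm1 i) in if i == ord0 then X ^+ 2 else X
    | i < n.+1].

(** The parts of [h] that are even and odd in the first variable. *)
Lemma square_decomposition (h : mpoly n.+1 K) :
  exists u v, h = (u \mPo S) + 'X_ord0 * (v \mPo S).
Proof.
have S0 : 'X_ord0 \mPo S = 'X_ord0 ^+ 2.
  by rewrite comp_mpolyXU -tnth_nth tnth_mktuple eqxx.
elim/mpoly_ring_ind: h =>
  [c|i|p q [a [b ->]] [c [d ->]]|p q [a [b ->]] [c [d ->]]].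
- by exists (mpolyC _ c), 0; rewrite comp_mpolyC comp_mpoly0 mulr0 addr0.
- have [->|i0] := eqVneq i ord0.
    by exists 0, 1; rewrite comp_mpoly0 comp_mpoly1 add0r mulr1.
  exists 'X_i, 0; rewrite comp_mpoly0 mulr0 addr0 comp_mpolyXU -tnth_nth.
  by rewrite tnth_mktuple (negPf i0).
- exists (a + c), (b + d); rewrite !comp_mpolyD; ring.
- exists (a * c + 'X_ord0 * (b * d)), (a * d + b * c).
  rewrite !comp_mpolyD !(rmorphM (comp_mpoly S)) /= S0; ring.
Qed.

Lemma even_polynomial (h : mpoly n.+1 K) :
  sign_invariant (fun i => if i == ord0 then -1 else 1) h ->
  exists u, h = u \mPo S.
Proof.
have [u [v ->]] := square_decomposition h => inv; exists u.
suff v0 : 'X_ord0 * (v \mPo S) = 0 by rewrite v0 addr0.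
apply: (mpoly_eq_off (oner_neq0 _)) => x _; rewrite meval0.
have := inv x; rewrite !mevalD !mevalM !mevalXU eqxx !meval_comp.
set Sx := pmap S (fun i => _); have -> : Sx = pmap S x.
  apply: funext => i; rewrite /Sx /pmap tnth_mktuple /=.
  case: (eqVneq i ord0) => [->|i0]; rewrite ?meval_exp !mevalXU ?eqxx.
    by rewrite mulN1r sqrrN.
  by rewrite (negPf i0) mul1r.
move=> /addrI; rewrite mulN1r mulNr => /esym/eqP.
by rewrite -addr_eq0 -mulr2n mulrn_eq0 /= => /eqP.
Qed.

Lemma square_first_surj y : exists x, pmap S x = y.
Proof.
exists (fun i => if i == ord0 then sqrtC (y i) else y i).
apply: funext => i; rewrite /pmap tnth_mktuple /=.
by case: eqP => [->|/eqP/negPf i0];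
  rewrite ?meval_exp mevalXU ?eqxx ?sqrtCK ?i0.
Qed.

End SquareFirst.

(** * Linear coordinates *)

Lemma involution_diagonalizable (K : numClosedFieldType) (n : nat)
    (A : 'M[K]_n.+1) :
  A *m A = 1%:M -> exists P (d : 'rV_n.+1),
    [/\ P \in unitmx, P *m A = diag_mx d *m P &
        forall i, d 0 i = 1 \/ d 0 i = -1].
Proof.
move=> AA; have /mxpoly.diagonalizableP[P uP /mxpoly.diagonalizable_forPex[d]] :
    exists2 rs, uniq rs & mxminpoly A %| \prod_(x <- rs) ('X - x%:P).
  exists [:: 1; -1].
    by rewrite /= inE andbT -subr_eq0 opprK -mulr2n mulrn_eq0 oner_eq0.
  apply: mxminpoly_min; rewrite big_cons big_seq1.
  have -> : ('X - 1%:P) * ('X - (-1)%:P) = 'X ^+ 2 - 1 :> {poly K}.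
    by rewrite polyCN polyC1; ring.
  rewrite rmorphB rmorph1 rmorphXn /= horner_mx_X expr2 -[A * A]/(A *m A) AA.
  exact: subrr.
move=> /(mxpoly.simmxP uP) PA; exists P, d; split=> // i.
have : diag_mx d *m diag_mx d *m P = P.
  by rewrite -mulmxA -PA mulmxA -PA -mulmxA AA mulmx1.
move=> /(congr1 (fun M => M *m invmx P));
  rewrite mulmxK // mulmxV // mulmx_diag.
move=> /matrixP/(_ i i); rewrite !mxE eqxx !mulr1n => /eqP.
by rewrite -expr2 sqrf_eq1 => /orP[/eqP|/eqP]; [left|right].
Qed.

Section Maps.

Variables (K : numClosedFieldType) (n : nat).

Definition comp_map (F G : n.-tuple (mpoly n K)) : n.-tuple (mpoly n K) :=
  [tuple tnth F i \mPo G | i < n].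

Lemma pmap_comp F G x : pmap (comp_map F G) x = pmap F (pmap G x).
Proof. by apply: funext => i; rewrite {1}/pmap tnth_mktuple meval_comp. Qed.

Definition linear_map (A : 'M[K]_n) : n.-tuple (mpoly n K) :=
  [tuple \sum_j A j i *: 'X_j | i < n].

Lemma pmap_linear A (x : 'rV_n) : pmap (linear_map A) (x 0) = (x *m A) 0.
Proof.
apply: funext => i; rewrite /pmap tnth_mktuple (raddf_sum (meval _)) mxE /=.
by apply: eq_bigr => j _; rewrite mevalZ mevalXU mulrC.
Qed.

Lemma diag_coord (d : 'rV[K]_n) (x : 'rV_n) :
  (x *m diag_mx d) 0 = (fun i => d 0 i * x 0 i).
Proof. by apply: funext => i; rewrite mul_mx_diag mxE mulrC. Qed.

End Maps.

Section Complex.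

Variables (R : realType) (n : nat).
Implicit Types F G : polynomial_mapping R n.

Lemma polymap_comp F G x : polymap (comp_map F G) x = polymap F (polymap G x).
Proof. by rewrite !polymapE pmap_comp row_coord. Qed.

Lemma polymap_linear (A : 'M[C R]_n) x : polymap (linear_map A) x = x *m A.
Proof. by rewrite polymapE pmap_linear; apply/rowP => i; rewrite mxE. Qed.

Lemma coord_inj (x y : 'rV[C R]_n) : x 0 = y 0 -> x = y.
Proof. by move=> E; apply/rowP => i; rewrite E. Qed.

Lemma polymap_coord F x : polymap F x 0 = pmap F (x 0).
Proof. by rewrite polymapE row_coord. Qed.

Lemma two_point_fibers (F : polynomial_mapping R n) :
  has_topological_degree F 2 -> forall y,
  (forall x, pmap F x = y -> (\det (jacobian F)).@[x] != 0) ->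
  exists u v, [/\ pmap F u = y, pmap F v = y, u <> v &
    forall x, pmap F x = y -> x = u \/ x = v].
Proof.
move=> deg y reg; have := deg (\row_i y i).
have nc : ~ critical_value F (\row_i y i).
  move=> [x xc Fx]; have Fx0 : pmap F (x 0) = y by rewrite -polymap_coord Fx
    row_coord.
  have /negP := reg _ Fx0; apply.
  rewrite -[_.@[_]]/(meval (x 0) _) -det_map_mx; apply/eqP; rewrite -[RHS]xc.
  by congr (\det _); apply/matrixP => i j; rewrite !mxE.
move=> /(_ nc); rewrite card_eq_sym => /card_set_bijP[h [hf hi hs]].
have m0 : (`I_2)%classic 0%N by []. have m1 : (`I_2)%classic 1%N by [].
have fibE x : (polymap F @^-1` [set \row_i y i])%classic x <-> pmap F (x 0) = y.
  rewrite /= -polymap_coord; split=> [->|E]; first by rewrite row_coord.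
  by apply: coord_inj; rewrite E row_coord.
exists (h 0%N 0), (h 1%N 0); split.
- by apply/fibE; apply: hf.
- by apply/fibE; apply: hf.
- by move=> /coord_inj; move/(hi _ _ (mem_set m0) (mem_set m1)).
move=> x Fx; have [|k /= k2 hk] := hs (\row_i x i).
  by apply/fibE; rewrite row_coord.
have -> : x = h k 0 by rewrite hk row_coord.
by case: k k2 {hk} => [|[|k]] //; [left|right].
Qed.

End Complex.

(** * The mapping in linearizing coordinates *)

Section Linearized.

Variables (R : realType) (n : nat).
Local Notation K := (C R).
Variables (f Phi Psi PsiInv : polynomial_mapping R n.+1) (A : 'M[K]_n.+1).

Hypothesis f_Phi : forall x, polymap f (polymap Phi x) = polymap f x.
Hypothesis f_gen : forall h : mpoly n.+1 K,
  (forall x, h.@[pmap Phi x] = h.@[x]) -> exists g, h = g \mPo f.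
Hypothesis PsiK : cancel (polymap Psi) (polymap PsiInv).
Hypothesis PsiInvK : cancel (polymap PsiInv) (polymap Psi).
Hypothesis linear_Phi : forall x, polymap PsiInv (polymap Phi (polymap Psi x))
  = x *m A.

Variables (P : 'M[K]_n.+1) (d : 'rV[K]_n.+1).
Hypothesis uP : P \in unitmx.
Hypothesis PA : P *m A = diag_mx d *m P.

Definition linearized : polynomial_mapping R n.+1 :=
  comp_map f (comp_map Psi (linear_map P)).

Lemma Phi_Psi x : polymap Phi (polymap Psi x) = polymap Psi (x *m A).
Proof. by rewrite -linear_Phi PsiInvK. Qed.

Lemma linearizedE x : polymap linearized x = polymap f (polymap Psi (x *m P)).
Proof. by rewrite !polymap_comp polymap_linear. Qed.

Lemma linearized_invariant j : sign_invariant (d 0) (tnth linearized j).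
Proof.
move=> x; have E : polymap linearized (\row_i x i *m diag_mx d) =
    polymap linearized (\row_i x i).
  by rewrite !linearizedE -mulmxA -PA mulmxA -Phi_Psi f_Phi.
have := congr1 (fun v : 'rV[K]_n.+1 => v 0 j) E.
by rewrite !mxE diag_coord !row_coord.
Qed.

Lemma linearized_generate h :
  sign_invariant (d 0) h -> exists g, h = g \mPo linearized.
Proof.
move=> inv.
have invr (x : 'rV[K]_n.+1) : h.@[(x *m diag_mx d) 0] = h.@[x 0].
  by rewrite diag_coord; apply: inv.
have AP : A *m invmx P = invmx P *m diag_mx d.
  by apply: (can_inj (mulKmx uP));
    rewrite !mulmxA PA mulmxK // mulmxV // mul1mx.
pose h' := h \mPo (comp_map (linear_map (invmx P)) PsiInv).
have h'E (x : 'rV[K]_n.+1) : h'.@[x 0] = h.@[(polymap PsiInv x *m invmx P) 0].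
  by rewrite meval_comp -polymap_coord polymap_comp polymap_linear.
have [g hg] : exists g, h' = g \mPo f.
  apply: f_gen => x; rewrite -[x]row_coord -polymap_coord !h'E.
  by rewrite -{1}[\row_i x i]PsiInvK linear_Phi -mulmxA AP mulmxA invr.
exists g; apply: (mpoly_eq_off (oner_neq0 _)) => x _.
rewrite meval_comp -[x]row_coord -polymap_coord linearizedE polymap_coord.
by rewrite -meval_comp -hg h'E PsiK mulmxK.
Qed.

End Linearized.

Theorem theorem1p16 (R : realType) (n : nat)
    (f : polynomial_mapping R n.+1) :
  proper_mapping (polymap f) ->
  has_topological_degree f 2 ->
  linearization_conjecture R n.+1 ->
  weakly_equivalent f (square_first R n).
Proof.
move=> f_proper /two_point_fibers deg2 conj.
have [z [delta zP]] := quadratic_generator_exists deg2.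
have [Phi [fPhi zPhi PhiPhi]] :=
  deck_involution_exists deg2 (proper_image_segment_bounded f_proper) zP.
have f_gen h := deck_invariant deg2 (proper_segment_bounded f_proper) zP (h :=
  h) fPhi zPhi.
have PhiK : cancel (polymap Phi) (polymap Phi).
  by move=> x; apply: coord_inj; rewrite !polymap_coord PhiPhi.
have Phi_neq_id : ~ (polymap Phi =1 id).
  move=> Phi1; have /eqP[] := quadratic_generator_neq0 zP.
  apply: (mpoly_eq_off (oner_neq0 _)) => x _; rewrite meval0.
  have := zPhi x; rewrite -{1}[x]row_coord -polymap_coord Phi1 row_coord =>
    /eqP.
  by rewrite -addr_eq0 -mulr2n mulrn_eq0 /= => /eqP.
have [||Psi [PsiInv [[PsiK PsiInvK] [A uA linA]]]] := conj Phi.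
- by exists Phi.
- by split=> // x; apply: PhiK.
have linPhi x : polymap PsiInv (polymap Phi (polymap Psi x)) = x *m A by apply:
  linA.
have AA : A *m A = 1%:M.
  apply/row_matrixP => i;
    rewrite !rowE mulmx1 mulmxA -!linPhi PsiInvK PhiK PsiK //.
have fPhi' x : polymap f (polymap Phi x) = polymap f x.
  by apply: coord_inj; rewrite !polymap_coord fPhi.
have inv P d PA := @linearized_invariant R n f Phi Psi PsiInv A fPhi' PsiInvK
  linPhi P d PA.
have gen P d uP PA := @linearized_generate R n f Phi Psi PsiInv A f_gen PsiK
  PsiInvK linPhi P d uP PA.
have [P [d [uP PA d1]]] := involution_diagonalizable AA.
have [i0 di0] : exists i, d 0 i = -1.
  apply: contrapT => /forallNP nd; apply: Phi_neq_id => x.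
  have d11 : diag_mx d = 1%:M.
    apply/matrixP => i j; rewrite !mxE; case: (d1 i) => [->//|/nd []].
  have A1 : A = 1%:M.
    by apply: (can_inj (mulKmx uP)); rewrite PA d11 mul1mx mulmx1.
  by rewrite -[x]PsiInvK (Phi_Psi PsiInvK linPhi) A1 mulmx1.
(* Exchanging two coordinates moves the sign -1 to the first place. *)
pose s := tperm ord0 i0; pose P' := row_perm s P; pose d' := col_perm s d.
have uP' : P' \in unitmx by rewrite /P' row_permE unitmx_mul unitmx_perm.
have PA' : P' *m A = diag_mx d' *m P'.
  apply/matrixP => i j; rewrite mul_diag_mx !mxE -[RHS]/(d 0 (s i) * P (s i) j).
  have /matrixP/(_ (s i) j) := PA; rewrite mul_diag_mx !mxE => <-.
  by apply: eq_bigr => k _; rewrite !mxE.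
have d'E : d' 0 = (fun i => if i == ord0 then -1 else 1).
  apply: funext => i; rewrite mxE; case: eqP => [->|/eqP i0'].
    by rewrite tpermL.
  have [->//|dsi] := d1 (s i).
  have := unique_sign d1 (inv P d PA) (gen P d uP PA) di0 dsi.
  by move=> si; case/eqP: i0'; rewrite -(tpermK ord0 i0 i) -/s -si tpermR.
pose G := linearized f Psi P'.
have G_inv j : sign_invariant (fun i => if i == ord0 then -1 else 1) (tnth G j).
  by rewrite -d'E; apply: inv.
have G_gen h : sign_invariant (fun i => if i == ord0 then -1 else 1) h ->
    exists g, h = g \mPo G.
  by rewrite -d'E; apply: gen.
(* [G] and the squaring map generate the same ring. *)
have /choice[U GU] : forall j, exists u, tnth G j = u \mPo square_first R n.
  by move=> j; apply: even_polynomial.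
have /choice[V SV] : forall j, exists v, tnth (square_first R n) j = v \mPo G.
  move=> j; apply: G_gen => x; rewrite tnth_mktuple.
  case: eqP => [->|/eqP/negPf j0]; rewrite ?meval_exp !mevalXU ?eqxx.
    by rewrite mulN1r sqrrN.
  by rewrite j0 mul1r.
pose Ut : polynomial_mapping R n.+1 := [tuple U j | j < n.+1].
pose Vt : polynomial_mapping R n.+1 := [tuple V j | j < n.+1].
have GUt x : polymap G x = polymap Ut (polymap (square_first R n) x).
  apply: coord_inj; rewrite !polymap_coord; apply: funext => j.
  by rewrite {1 2}/pmap GU meval_comp tnth_mktuple.
have SVt x : polymap (square_first R n) x = polymap Vt (polymap G x).
  apply: coord_inj; rewrite !polymap_coord; apply: funext => j.
  by rewrite {1 2}/pmap SV meval_comp tnth_mktuple.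
have UV : cancel (polymap Ut) (polymap Vt).
  move=> y; have [x Sx] := square_first_surj (y 0).
  have -> : y = polymap (square_first R n) (\row_i x i).
    by apply: coord_inj; rewrite polymap_coord row_coord.
  by rewrite -GUt -SVt.
have VU : cancel (polymap Vt) (polymap Ut).
  move=> y; have [x fx] := pmap_surj deg2 (y 0).
  have -> : y = polymap G (polymap PsiInv (\row_i x i) *m invmx P').
    rewrite linearizedE mulmxKV // PsiInvK.
    by apply: coord_inj; rewrite polymap_coord row_coord.
  by rewrite -SVt -GUt.
exists (comp_map Psi (linear_map P')), Vt; split.
- exists (comp_map (linear_map (invmx P')) PsiInv); split=> x.
    by rewrite !polymap_comp PsiK !polymap_linear mulmxK.
  by rewrite !polymap_comp !polymap_linear mulmxKV // PsiInvK.
- by exists Ut.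
by move=> x; apply: (etrans (SVt x)); congr (polymap Vt _); apply: polymap_comp.
Qed.
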